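(* A pair $(C,L)$ consisting of a cubic curve $C$ and a line $L$ on $\mathbb{P}^2$ is semistable if and only if all of the following are true: (i) $C$ is reduced and does not have a triple point; (ii) $L$ is not contained in $C$; (iii) $L$ does not pass through any double point of $C$; (iv) $L$ is not a triple tangent to $C$.
   Context: Let $k$ be an algebraically closed field of characteristic not $2$ or $3$, $\mathbb{P}^2=\mathrm{Proj}\,k[x_0,x_1,x_2]$, $V^\vee=k[x_0,x_1,x_2]_1$. Pairs $(C,L)=(V(F),V(S))$ with $F$ a nonzero cubic form and $S$ a nonzero linear form are points of $\mathbb{P}(S^3V)\times\mathbb{P}(V)\simeq\mathbb{P}^9\times\mathbb{P}^2$, on which $\mathrm{PGL}(3)$ acts by $g\cdot(V(F(x)),V(S(x)))=(V(F(g^{-1}x)),V(S(g^{-1}x)))$. Semistability is in the sense of geometric invariant theory, with respect to the $\mathrm{SL}(3)$-linearized bundle $\mathcal{O}(1,1)$ (pulled back from $\mathbb{P}(S^3V\otimes V)$ via the Segre embedding). $L$ is a triple tangent to $C$ if $L\not\subset C$ and $L$ meets $C$ in a single point with multiplicity $3$; a double (triple) point of $C$ is a point of multiplicity $2$ (resp. $3$) on $C$. *)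

(* Defs.v *)
From HB Require Import structures.
From mathcomp Require Import all_boot all_order all_algebra.
From mathcomp Require Export mpoly.

Set Implicit Arguments.
Unset Strict Implicit.
Unset Printing Implicit Defensive.

Import GRing.Theory.
Local Open Scope ring_scope.

(* A point of the projective plane
   is given by a nonzero row vector of homogeneous coordinates, a cubic curve
   V(F) (resp. a line V(S)) by a nonzero form F of degree 3 (resp. 1). *)

Section CubicLinePairs.

Variable k : closedFieldType.

Implicit Types (F S : {mpoly k[3]}) (p q : 'rV[k]_3).

Definition is_form (d : nat) F : Prop := F \is d.-homog.

Definition on_curve F p : Prop := F.@[fun i => p 0 i] = 0.

(* [act g F] is the form F(g^-1 x), x being the column of the variables. *)
Definition act (g : 'M[k]_3) F : {mpoly k[3]} :=
  F \mPo [tuple \sum_j invmx g i j *: 'X_j | i < 3].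

Definition cubic_exponents : 10.-tuple 'X_{1..3} :=
  [tuple [multinom of [:: 3; 0; 0]]; [multinom of [:: 2; 1; 0]];
         [multinom of [:: 2; 0; 1]]; [multinom of [:: 1; 2; 0]];
         [multinom of [:: 1; 1; 1]]; [multinom of [:: 1; 0; 2]];
         [multinom of [:: 0; 3; 0]]; [multinom of [:: 0; 2; 1]];
         [multinom of [:: 0; 1; 2]]; [multinom of [:: 0; 0; 3]]]%N.

(* Homogeneous coordinates on P^9 x P^2: the ten coefficients of F, then the
   three coefficients of S. *)
Definition coords F S (i : 'I_(10 + 3)) : k :=
  match split i with
  | inl a => F@_(tnth cubic_exponents a)
  | inr b => S@_(U_(b))
  end.

(* The sections of O(a, b) on P^9 x P^2 are the polynomials that are
   homogeneous of degree a in the coefficients of the cubic and homogeneous of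
   degree b in those of the line. *)
Definition section_O (a b : nat) (s : {mpoly k[10 + 3]}) : Prop :=
  forall m : 'X_{1..10 + 3}, m \in msupp s ->
    (\sum_(i < 10) m (lshift 3 i) = a)%N /\ (\sum_(i < 3) m (rshift 10 i) = b)%N.

Definition SL3_invariant (s : {mpoly k[10 + 3]}) : Prop :=
  forall (g : 'M[k]_3) F S, \det g = 1 -> is_form 3 F -> is_form 1 S ->
    s.@[coords (act g F) (act g S)] = s.@[coords F S].

(* Some SL(3)-invariant section of a positive power of O(1, 1) does not vanish
   at (V(F), V(S)).  Mumford's additional requirement that the nonvanishing
   locus of the section be affine is automatic, since O(1, 1) is ample and
   P^9 x P^2 is projective. *)
Definition semistable F S : Prop :=
  exists (d : nat) (s : {mpoly k[10 + 3]}),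
    [/\ (0 < d)%N, section_O d d s, SL3_invariant s & s.@[coords F S] != 0].

(* V(F) has no multiple component. *)
Definition reduced F : Prop :=
  forall G H : {mpoly k[3]}, F = G ^+ 2 * H -> (msize G <= 1)%N.

(* The affine equation of V(F) in the chart x_i != 0, translated so that p
   becomes the origin.  The variable 'X_i no longer occurs in it. *)
Definition local_equation F p (i : 'I_3) : {mpoly k[3]} :=
  F \mPo [tuple if j == i then 1 else 'X_j + (p 0 j / p 0 i)%:MP | j < 3].

Definition order_at_origin (f : {mpoly k[3]}) (r : nat) : Prop :=
  (forall m : 'X_{1..3}, f@_m != 0 -> (r <= mdeg m)%N) /\
  (exists2 m : 'X_{1..3}, f@_m != 0 & mdeg m = r).

(* The multiplicity does not depend on the chart containing p. *)
Definition point_of_multiplicity (r : nat) F p : Prop :=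
  exists2 i : 'I_3, p 0 i != 0 & order_at_origin (local_equation F p i) r.

Definition double_point F p : Prop := point_of_multiplicity 2 F p.
Definition triple_point F p : Prop := point_of_multiplicity 3 F p.

Definition line_in_curve F S : Prop :=
  forall p, p != 0 -> on_curve S p -> on_curve F p.

(* The restriction of F to the line through p and q, as a polynomial in the
   local parameter t at p of the parametrization p + t q. *)
Definition restriction F p q : {poly k} :=
  mmap (@polyC k) (fun i => (p 0 i)%:P + q 0 i *: 'X) F.

(* For p on V(S), V(S) not contained in V(F): the intersection multiplicity at
   p of V(F) and V(S) is r.  It does not depend on the second point q of the
   line. *)
Definition intersection_multiplicity F S p (r : nat) : Prop :=
  exists q, [/\ on_curve S q, ~~ (q <= p)%MS & mup 0 (restriction F p q) = r].

Definition triple_tangent F S : Prop :=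
  ~ line_in_curve F S /\
  exists p,
    [/\ p != 0, on_curve F p, on_curve S p,
        forall q, on_curve F q -> on_curve S q -> (q <= p)%MS
      & intersection_multiplicity F S p 3].

End CubicLinePairs.

(* Main.v *)
Require Import Defs.
From mathcomp Require Import all_boot all_order all_algebra.
From mathcomp Require Import ring.

Set Implicit Arguments.
Unset Strict Implicit.
Unset Printing Implicit Defensive.

Import Order.TTheory GRing.Theory Num.Theory.
Local Open Scope ring_scope.

(* Let T be the symmetric trilinear form with T(x, x, x) = 6 F(x), and s the
   row of coefficients of S.

   If one of the conditions fails, some basis of k^3 and some one-parameter
   subgroup of SL(3) that is diagonal in it act with positive weights on all the
   products of a coefficient of F and a coefficient of S, so that every
   invariant section tends to 0 along the orbit, hence vanishes.  A multiple
   component of C meets L in a singular point of C.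

   Conversely, nonvanishing invariants are written down explicitly.  Let M be
   the conic of the points p whose polar conic T(p, ., .) is tangent to L.
   Besides det M, use the linear form w obtained by contracting T with the dual
   of M, and the cross product p of s and w:
     det M,  adj(M)(s, w),  M(p, p),  T(p, p, p)^2 adj(M)(s, s)
   have bidegrees (6, 6), (9, 9), (12, 12), (36, 36).  If the conditions
   hold and F has a double root on L, then det M <> 0.  If F has three distinct
   roots on L, then coordinates x, y, z with L = {z = 0} exist in which
     F = a x^3 + d y^3 + 6 b x y z + (e x + f y) z^2 + g z^3,
   and the four invariants are, up to nonzero factors, b^2 and, when b = 0,
   g, e f and (a f^3 - d e^3)^2; if all of them vanish, (0 : 0 : 1) is a triple
   point. *)

(** * Indices of the three coordinates *)

Definition i0 : 'I_3 := inord 0.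
Definition i1 : 'I_3 := inord 1.
Definition i2 : 'I_3 := inord 2.

Lemma ord3P (P : 'I_3 -> Prop) : P i0 -> P i1 -> P i2 -> forall i, P i.
Proof.
move=> P0 P1 P2 i; suff [->|->|->] : [\/ i = i0, i = i1 | i = i2] by [].
by case: i => -[|[|[]]] // ?; [apply: Or31|apply: Or32|apply: Or33];
   apply/val_inj; rewrite /= inordK.
Qed.

Lemma ord3E : (i0 == i1 = false) * (i0 == i2 = false) * (i1 == i0 = false)
  * (i1 == i2 = false) * (i2 == i0 = false) * (i2 == i1 = false).
Proof. by do !split; rewrite -val_eqE /= !inordK. Qed.

Lemma sum3E (V : nmodType) (f : 'I_3 -> V) :
  \sum_i f i = f i0 + f i1 + f i2.
Proof.
rewrite !big_ord_recl big_ord0 addr0 addrA.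
by congr (f _ + f _ + f _); apply/val_inj; rewrite /= inordK.
Qed.

(** * Determinants and cross products in dimension 3 *)

Section Det3.
Variable R : comNzRingType.
Implicit Types (A B : 'M[R]_3).

Lemma det2E (A : 'M[R]_2) :
  \det A = A ord0 ord0 * A ord_max ord_max - A ord0 ord_max * A ord_max ord0.
Proof.
rewrite (expand_det_row _ ord0) !big_ord_recl big_ord0.
rewrite /cofactor !det_mx11 !mxE /=.
rewrite addr0 expr0 mul1r /= /bump /= expr1 mulN1r mulrN.
by congr (A _ _ * A _ _ - A _ _ * A _ _); apply/val_inj.
Qed.

Lemma cofactor3E A :
  (cofactor A i0 i0 = A i1 i1 * A i2 i2 - A i1 i2 * A i2 i1) *
  (cofactor A i0 i1 = A i1 i2 * A i2 i0 - A i1 i0 * A i2 i2) *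
  (cofactor A i0 i2 = A i1 i0 * A i2 i1 - A i1 i1 * A i2 i0) *
  (cofactor A i1 i0 = A i0 i2 * A i2 i1 - A i0 i1 * A i2 i2) *
  (cofactor A i1 i1 = A i0 i0 * A i2 i2 - A i0 i2 * A i2 i0) *
  (cofactor A i1 i2 = A i0 i1 * A i2 i0 - A i0 i0 * A i2 i1) *
  (cofactor A i2 i0 = A i0 i1 * A i1 i2 - A i0 i2 * A i1 i1) *
  (cofactor A i2 i1 = A i0 i2 * A i1 i0 - A i0 i0 * A i1 i2) *
  (cofactor A i2 i2 = A i0 i0 * A i1 i1 - A i0 i1 * A i1 i0).
Proof.
have l0 : (lift i0 (ord0 : 'I_2) = i1) * (lift i0 (ord_max : 'I_2) = i2).
  by split; apply/val_inj; rewrite /= !inordK.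
have l1 : (lift i1 (ord0 : 'I_2) = i0) * (lift i1 (ord_max : 'I_2) = i2).
  by split; apply/val_inj; rewrite /= !inordK.
have l2 : (lift i2 (ord0 : 'I_2) = i0) * (lift i2 (ord_max : 'I_2) = i1).
  by split; apply/val_inj; rewrite /= !inordK.
by do !split; rewrite /cofactor det2E !mxE !(l0, l1, l2) !inordK //=; ring.
Qed.

Lemma adj3E A :
  (\adj A i0 i0 = A i1 i1 * A i2 i2 - A i1 i2 * A i2 i1) *
  (\adj A i1 i0 = A i1 i2 * A i2 i0 - A i1 i0 * A i2 i2) *
  (\adj A i2 i0 = A i1 i0 * A i2 i1 - A i1 i1 * A i2 i0) *
  (\adj A i0 i1 = A i0 i2 * A i2 i1 - A i0 i1 * A i2 i2) *
  (\adj A i1 i1 = A i0 i0 * A i2 i2 - A i0 i2 * A i2 i0) *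
  (\adj A i2 i1 = A i0 i1 * A i2 i0 - A i0 i0 * A i2 i1) *
  (\adj A i0 i2 = A i0 i1 * A i1 i2 - A i0 i2 * A i1 i1) *
  (\adj A i1 i2 = A i0 i2 * A i1 i0 - A i0 i0 * A i1 i2) *
  (\adj A i2 i2 = A i0 i0 * A i1 i1 - A i0 i1 * A i1 i0).
Proof. by do !split; rewrite !mxE cofactor3E. Qed.

Lemma det3E A :
  \det A = A i0 i0 * (A i1 i1 * A i2 i2 - A i1 i2 * A i2 i1)
         + A i0 i1 * (A i1 i2 * A i2 i0 - A i1 i0 * A i2 i2)
         + A i0 i2 * (A i1 i0 * A i2 i1 - A i1 i1 * A i2 i0).
Proof. by rewrite (expand_det_row _ i0) sum3E !cofactor3E. Qed.

Lemma adj3_mulmx A B : \adj (A *m B) = \adj B *m \adj A.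
Proof.
apply/matrixP; apply: ord3P; apply: ord3P.
all: by rewrite [RHS]mxE sum3E !adj3E !mxE !sum3E; ring.
Qed.

(* u *m cross s is the cross product s x u. *)
Definition cross (s : 'rV[R]_3) : 'M[R]_3 := \matrix_(i, j)
  (((i == i0) && (j == i1))%:R * s 0 i2 - ((i == i1) && (j == i0))%:R * s 0 i2
 + ((i == i1) && (j == i2))%:R * s 0 i0 - ((i == i2) && (j == i1))%:R * s 0 i0
 + ((i == i2) && (j == i0))%:R * s 0 i1 - ((i == i0) && (j == i2))%:R * s 0 i1).

(** Equivariance of the cross product, a polynomial identity in the entries; for det h = 1 it is the
    source of the invariance of all the constructions below. *)
Lemma cross_mulmx (h : 'M[R]_3) s :
  h *m cross (s *m h) *m h^T = \det h *: cross s.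
Proof.
apply/matrixP; apply: ord3P; apply: ord3P.
all: rewrite det3E !mxE !sum3E !mxE !sum3E !mxE !sum3E !(ord3E, eqxx) /=; ring.
Qed.

End Det3.

(** * Symmetric trilinear forms and their invariants *)

Section Tensors.
Variable R : comNzRingType.
Implicit Types (T : 'I_3 -> 'M[R]_3) (u v w s : 'rV[R]_3) (h : 'M[R]_3).

(** A trilinear form is encoded by its slices: [T k] is the matrix of T(., ., e_k), and
    [contract T w] that of T(., ., w). *)
Definition contract T w : 'M[R]_3 := \sum_k w 0 k *: T k.

Definition tri T u v w : R := (u *m contract T w *m v^T) 0 0.

Definition symmetric_tensor T :=
  (forall i j k, T k i j = T k j i) /\ (forall i j k, T k i j = T j i k).

(** The trilinear form T(h x, h y, h z), where x, y, z are columns. *)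
Definition pullback h T k : 'M[R]_3 := h^T *m contract T (row k h^T) *m h.

(** For a symmetric matrix A, the trace of (A [cross s])^2 is -2 s adj(A) s^T, which vanishes when L
    is tangent to the conic A. With A = T(p, ., .), polarizing in p gives the matrix M. *)
Definition polar_conic T s : 'M[R]_3 :=
  \matrix_(k, l) \tr (T k *m cross s *m T l *m cross s).

Definition apolar T s : 'rV[R]_3 :=
  \row_k \tr (\adj (polar_conic T s) *m T k).

(** The point where L meets the line w = 0, or 0 if w is proportional to s. *)
Definition apolar_pole T s : 'rV[R]_3 := apolar T s *m cross s.

Definition inv1 T s : R := \det (polar_conic T s).
Definition inv2 T s : R :=
  (s *m \adj (polar_conic T s) *m (apolar T s)^T) 0 0.
Definition inv3 T s : R :=
  (apolar_pole T s *m polar_conic T s *m (apolar_pole T s)^T) 0 0.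
Definition inv4 T s : R :=
  tri T (apolar_pole T s) (apolar_pole T s) (apolar_pole T s) ^+ 2
  * (s *m \adj (polar_conic T s) *m s^T) 0 0.

Lemma contractD T v w : contract T (v + w) = contract T v + contract T w.
Proof.
by rewrite /contract -big_split; apply: eq_bigr => k _; rewrite mxE scalerDl.
Qed.

Lemma contractZ T a w : contract T (a *: w) = a *: contract T w.
Proof.
by rewrite /contract scaler_sumr; apply: eq_bigr => k _; rewrite mxE scalerA.
Qed.

Lemma contract_delta T k : contract T (delta_mx 0 k) = T k.
Proof.
rewrite /contract (bigD1 k) //= mxE !eqxx scale1r big1 ?addr0 // => l /negPf nlk.
by rewrite mxE nlk andbF scale0r.
Qed.

Lemma tri_sumE T u v w :
  tri T u v w = \sum_k \sum_j \sum_i T k i j * (u 0 i * v 0 j * w 0 k).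
Proof.
rewrite /tri /contract mulmx_sumr mulmx_suml summxE; apply: eq_bigr => k _.
rewrite -scalemxAr -scalemxAl mxE mxE mulr_sumr; apply: eq_bigr => j _.
rewrite !mxE mulr_suml mulr_sumr; apply: eq_bigr => i _; ring.
Qed.

Lemma triDl T u u' v w : tri T (u + u') v w = tri T u v w + tri T u' v w.
Proof. by rewrite /tri !mulmxDl mxE. Qed.

Lemma triZl T a u v w : tri T (a *: u) v w = a * tri T u v w.
Proof. by rewrite /tri -!scalemxAl mxE. Qed.

Lemma triDm T u v v' w : tri T u (v + v') w = tri T u v w + tri T u v' w.
Proof. by rewrite /tri linearD /= mulmxDr mxE. Qed.

Lemma triZm T a u v w : tri T u (a *: v) w = a * tri T u v w.
Proof. by rewrite /tri linearZ /= -scalemxAr mxE. Qed.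

Lemma triDr T u v w w' : tri T u v (w + w') = tri T u v w + tri T u v w'.
Proof. by rewrite /tri contractD mulmxDr mulmxDl mxE. Qed.

Lemma triZr T a u v w : tri T u v (a *: w) = a * tri T u v w.
Proof. by rewrite /tri contractZ -scalemxAr -scalemxAl mxE. Qed.

Definition triE :=
  (triDl, triDm, triDr, triZl, triZm, triZr).

Lemma tri_delta T i j k :
  tri T (delta_mx 0 i) (delta_mx 0 j) (delta_mx 0 k) = T k i j.
Proof. by rewrite /tri contract_delta -rowE trmx_delta -colE !mxE. Qed.

Lemma tri_sym12 T u v w : symmetric_tensor T -> tri T u v w = tri T v u w.
Proof.
case=> sT _; rewrite !tri_sumE; apply: eq_bigr => k _.
rewrite exchange_big; apply: eq_bigr => j _; apply: eq_bigr => i _.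
by rewrite sT; ring.
Qed.

Lemma tri_sym23 T u v w : symmetric_tensor T -> tri T u v w = tri T u w v.
Proof.
case=> _ sT; rewrite !tri_sumE exchange_big; apply: eq_bigr => j _.
by apply: eq_bigr => k _; apply: eq_bigr => i _; rewrite sT; ring.
Qed.

Lemma tri_sym13 T u v w : symmetric_tensor T -> tri T u v w = tri T w v u.
Proof. by move=> sT; rewrite tri_sym12 // tri_sym23 // tri_sym12. Qed.

Lemma contract_pullback h T w :
  contract (pullback h T) w = h^T *m contract T (w *m h^T) *m h.
Proof.
rewrite /contract /pullback.
transitivity (\sum_k h^T *m contract T (w 0 k *: row k h^T) *m h).
  apply: eq_bigr => k _.
  by rewrite contractZ -scalemxAr -scalemxAl.
rewrite -mulmx_suml -mulmx_sumr; congr (_ *m _ *m _).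
rewrite -/(contract T _) mulmx_sum_row.
rewrite (big_morph _ (contractD T) (_ : contract T 0 = 0)) //.
by rewrite -(scale0r 0) contractZ scale0r.
Qed.

Lemma tri_pullback h T u v w :
  tri (pullback h T) u v w = tri T (u *m h^T) (v *m h^T) (w *m h^T).
Proof. by rewrite /tri contract_pullback trmx_mul trmxK !mulmxA. Qed.

Lemma pullbackE h T i j k :
  pullback h T k i j = tri T (row i h^T) (row j h^T) (row k h^T).
Proof. by rewrite -tri_delta tri_pullback !rowE. Qed.

Lemma pullback_sym h T : symmetric_tensor T -> symmetric_tensor (pullback h T).
Proof.
move=> sT; split=> i j k; rewrite !pullbackE; first exact: tri_sym12.
exact: tri_sym23.
Qed.

Lemma polarization T u v w : symmetric_tensor T ->
  6 * tri T u v w = tri T (u + v + w) (u + v + w) (u + v + w)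
    - tri T (u + v) (u + v) (u + v) - tri T (u + w) (u + w) (u + w)
    - tri T (v + w) (v + w) (v + w)
    + tri T u u u + tri T v v v + tri T w w w.
Proof.
move=> sT; rewrite !triE.
have -> : tri T u w v = tri T u v w by apply: tri_sym23.
have -> : tri T v u w = tri T u v w by apply: tri_sym12.
have -> : tri T w v u = tri T u v w by apply: tri_sym13.
have -> : tri T v w u = tri T u v w by rewrite tri_sym13 // tri_sym23.
have -> : tri T w u v = tri T u v w by rewrite tri_sym12 // tri_sym23.
ring.
Qed.

Section UnimodularInvariance.
Variables (h : 'M[R]_3) (T : 'I_3 -> 'M[R]_3) (s : 'rV[R]_3).
Hypothesis deth : \det h = 1.

(** Over an arbitrary commutative ring, [\adj h] serves as the inverse of h; all cancellations below
    go through it. *)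
Lemma unimodular_adj : (\adj h *m h = 1%:M) * (h *m \adj h = 1%:M) *
  ((\adj h)^T *m h^T = 1%:M) * (h^T *m (\adj h)^T = 1%:M).
Proof. by rewrite -!trmx_mul !(mul_adj_mx, mul_mx_adj) deth trmx1. Qed.

Let cross_h : cross (s *m h) = \adj h *m cross s *m (\adj h)^T.
Proof.
by rewrite -[cross s]scale1r -deth -cross_mulmx !mulmxA unimodular_adj mul1mx
           -mulmxA unimodular_adj mulmx1.
Qed.

(** The product of a slice and [cross s] is an endomorphism: a change of coordinates conjugates it
    by [h^T], so traces of products of such matrices are preserved. *)
Let slice_cross k : pullback h T k *m cross (s *m h) =
  h^T *m (contract T (row k h^T) *m cross s) *m (\adj h)^T.
Proof.
by rewrite /pullback cross_h !mulmxA -[_ *m h *m _]mulmxA unimodular_adj mulmx1.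
Qed.

Let trace_conj A : \tr (h^T *m A *m (\adj h)^T) = \tr A.
Proof. by rewrite mxtrace_mulC mulmxA unimodular_adj mul1mx. Qed.

Lemma polar_conic_pullback :
  polar_conic (pullback h T) (s *m h) = h^T *m polar_conic T s *m h.
Proof.
(* The definition of M, extended bilinearly from the slices to arbitrary contractions. *)
have slices u v : \tr (contract T u *m cross s *m contract T v *m cross s) =
    (u *m polar_conic T s *m v^T) 0 0.
  rewrite /contract !mulmx_suml raddf_sum [in RHS]mxE /=.
  under [RHS]eq_bigr => l _ do rewrite mxE mulr_suml.
  rewrite [RHS]exchange_big; apply: eq_bigr => k _.
  rewrite mulmx_sumr mulmx_suml raddf_sum; apply: eq_bigr => l _.
  rewrite -!(scalemxAl, scalemxAr). rewrite /= !mxtraceZ !mxE; ring.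
apply/matrixP=> k l; rewrite mxE -mulmxA !slice_cross.
have -> B C : h^T *m B *m (\adj h)^T *m (h^T *m C *m (\adj h)^T) =
              h^T *m (B *m C) *m (\adj h)^T.
  by rewrite !mulmxA -[_ *m (\adj h)^T *m h^T]mulmxA unimodular_adj mulmx1.
rewrite trace_conj !mulmxA slices.
rewrite -row_mul mxE [RHS]mxE; apply: eq_bigr => j _.
by congr (_ * _); rewrite !mxE.
Qed.

Lemma apolar_pullback : apolar (pullback h T) (s *m h) = apolar T s *m h.
Proof.
have apolarE v : \tr (\adj (polar_conic T s) *m contract T v) =
    (apolar T s *m v^T) 0 0.
  rewrite /contract mulmx_sumr raddf_sum mxE /=; apply: eq_bigr => k _.
  by rewrite -scalemxAr mxtraceZ !mxE mulrC.
apply/rowP=> k; rewrite mxE polar_conic_pullback !adj3_mulmx.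
rewrite mxtrace_mulC /pullback -!mulmxA [h *m _]mulmxA unimodular_adj mul1mx.
rewrite mxtrace_mulC -!mulmxA -trmx_adj unimodular_adj mulmx1.
rewrite mxtrace_mulC apolarE.
by rewrite !mxE; apply: eq_bigr => j _; rewrite !mxE.
Qed.

Lemma apolar_pole_pullback :
  apolar_pole (pullback h T) (s *m h) = apolar_pole T s *m (\adj h)^T.
Proof.
rewrite /apolar_pole apolar_pullback cross_h !mulmxA.
by rewrite -[_ *m h *m _]mulmxA unimodular_adj mulmx1.
Qed.

Lemma inv1_pullback : inv1 (pullback h T) (s *m h) = inv1 T s.
Proof.
by rewrite /inv1 polar_conic_pullback !det_mulmx det_tr deth mul1r mulr1.
Qed.

Let adj_polar_conic u v :
  u *m h *m \adj (polar_conic (pullback h T) (s *m h)) *m (v *m h)^T =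
  u *m \adj (polar_conic T s) *m v^T.
Proof.
rewrite polar_conic_pullback !adj3_mulmx -trmx_adj trmx_mul !mulmxA.
rewrite -[u *m h *m _]mulmxA unimodular_adj mulmx1.
by rewrite -[_ *m (\adj h)^T *m _]mulmxA unimodular_adj mulmx1.
Qed.

Lemma inv2_pullback : inv2 (pullback h T) (s *m h) = inv2 T s.
Proof. by rewrite /inv2 apolar_pullback adj_polar_conic. Qed.

Lemma inv3_pullback : inv3 (pullback h T) (s *m h) = inv3 T s.
Proof.
rewrite /inv3 apolar_pole_pullback polar_conic_pullback trmx_mul trmxK !mulmxA.
rewrite -[_ *m (\adj h)^T *m _]mulmxA unimodular_adj mulmx1.
by rewrite -[_ *m h *m _]mulmxA unimodular_adj mulmx1.
Qed.

Lemma inv4_pullback : inv4 (pullback h T) (s *m h) = inv4 T s.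
Proof.
rewrite /inv4 adj_polar_conic tri_pullback apolar_pole_pullback.
by rewrite -[_ *m _ *m h^T]mulmxA unimodular_adj mulmx1.
Qed.

End UnimodularInvariance.
End Tensors.

(** * Compatibility of the invariants with ring homomorphisms *)

Section Naturality.
Variables (R R' : comNzRingType) (f : {rmorphism R -> R'}).
Implicit Types (T : 'I_3 -> 'M[R]_3) (s : 'rV[R]_3).

Definition map_tensor T k : 'M[R']_3 := map_mx f (T k).

Lemma map_cross s : map_mx f (cross s) = cross (map_mx f s).
Proof.
by apply/matrixP=> i j; rewrite !mxE !(rmorphD, rmorphN, rmorphM, rmorph_nat).
Qed.

Lemma map_contract T w :
  map_mx f (contract T w) = contract (map_tensor T) (map_mx f w).
Proof.
by rewrite /contract map_mx_sum; apply: eq_bigr => k _; rewrite map_mxZ mxE.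
Qed.

Lemma map_tri T u v w :
  f (tri T u v w) = tri (map_tensor T) (map_mx f u) (map_mx f v) (map_mx f w).
Proof. by rewrite /tri -map_contract map_trmx -!map_mxM [RHS]mxE. Qed.

Lemma map_polar_conic T s :
  map_mx f (polar_conic T s) = polar_conic (map_tensor T) (map_mx f s).
Proof.
by apply/matrixP=> k l; rewrite !mxE -map_cross -!map_mxM trace_map_mx.
Qed.

Lemma map_apolar T s :
  map_mx f (apolar T s) = apolar (map_tensor T) (map_mx f s).
Proof.
apply/rowP=> k.
by rewrite !mxE -map_polar_conic -map_mx_adj -!map_mxM trace_map_mx.
Qed.

Lemma map_apolar_pole T s :
  map_mx f (apolar_pole T s) = apolar_pole (map_tensor T) (map_mx f s).
Proof. by rewrite map_mxM map_apolar map_cross. Qed.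

Lemma map_inv1 T s : f (inv1 T s) = inv1 (map_tensor T) (map_mx f s).
Proof. by rewrite /inv1 -map_polar_conic det_map_mx. Qed.

Lemma map_inv2 T s : f (inv2 T s) = inv2 (map_tensor T) (map_mx f s).
Proof.
by rewrite /inv2 -map_polar_conic -map_apolar -map_mx_adj map_trmx -!map_mxM
           [RHS]mxE.
Qed.

Lemma map_inv3 T s : f (inv3 T s) = inv3 (map_tensor T) (map_mx f s).
Proof.
by rewrite /inv3 -map_polar_conic -map_apolar_pole map_trmx -!map_mxM [RHS]mxE.
Qed.

Lemma map_inv4 T s : f (inv4 T s) = inv4 (map_tensor T) (map_mx f s).
Proof.
rewrite /inv4 -map_apolar_pole -map_tri -map_polar_conic -map_mx_adj map_trmx.
by rewrite -!map_mxM rmorphM rmorphXn [map_mx _ _ _ _]mxE.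
Qed.

End Naturality.

(** * Bidegrees *)

Section Bidegree.
Variable k : closedFieldType.
Implicit Types (p q : {mpoly k[10 + 3]}) (a b c d : nat).

Lemma section_O0 a b : section_O a b (0 : {mpoly k[10 + 3]}).
Proof. by move=> m; rewrite msupp0. Qed.

Lemma section_OD a b p q :
  section_O a b p -> section_O a b q -> section_O a b (p + q).
Proof. by move=> Op Oq m /msuppD_le; rewrite mem_cat => /orP[/Op|/Oq]. Qed.

Lemma section_ON a b p : section_O a b p -> section_O a b (- p).
Proof. by move=> Op m; rewrite (perm_mem (msuppN p)) => /Op. Qed.

Lemma section_OM a b c d p q :
  section_O a b p -> section_O c d q -> section_O (a + c) (b + d) (p * q).
Proof.
move=> Op Oq m /msuppM_le/allpairsP[[m1 m2] /= [/Op[ea eb] /Oq[ec ed] ->]].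
by split; rewrite -?ea -?eb -?ec -?ed -big_split; apply: eq_bigr => i _;
   rewrite mnmDE.
Qed.

Lemma section_O_sum a b (I : finType) (P : pred I) (F : I -> {mpoly k[10 + 3]}) :
  (forall i, section_O a b (F i)) -> section_O a b (\sum_(i | P i) F i).
Proof.
move=> OF; elim/big_rec: _ => [|i p _]; first exact: section_O0.
exact/section_OD.
Qed.

Lemma section_OMn a b p n : section_O a b p -> section_O a b (p *+ n).
Proof.
move=> Op; elim: n => [|n IH]; first exact: section_O0.
by rewrite mulrS; apply: section_OD.
Qed.

Definition section_mx a b m n (A : 'M[{mpoly k[10 + 3]}]_(m, n)) :=
  forall i j, section_O a b (A i j).

Lemma section_mulmx a b c d m n r (A : 'M_(m, n)) (B : 'M_(n, r)) :
  section_mx a b A -> section_mx c d B -> section_mx (a + c) (b + d) (A *m B).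
Proof.
by move=> OA OB i j; rewrite mxE; apply: section_O_sum => l; apply: section_OM.
Qed.

Lemma section_trmx a b m n (A : 'M_(m, n)) :
  section_mx a b A -> section_mx a b A^T.
Proof. by move=> OA i j; rewrite mxE. Qed.

Lemma section_trace a b n (A : 'M_n) : section_mx a b A -> section_O a b (\tr A).
Proof. by move=> OA; apply: section_O_sum. Qed.

Lemma section_adj a b (A : 'M_3) :
  section_mx a b A -> section_mx (a + a) (b + b) (\adj A).
Proof.
move=> OA; apply: ord3P; apply: ord3P; rewrite adj3E;
  apply: section_OD; try apply: section_ON; exact: section_OM.
Qed.

Lemma section_det a b (A : 'M_3) :
  section_mx a b A -> section_O (a + (a + a)) (b + (b + b)) (\det A).
Proof.
move=> OA; have OadjA := section_adj OA.
rewrite (expand_det_row _ ord0); apply: section_O_sum => j.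
by apply: section_OM => //; have := OadjA j ord0; rewrite mxE.
Qed.

Lemma section_cross a b (s : 'rV_3) :
  section_mx a b s -> section_mx a b (cross s).
Proof.
move=> Os i j; rewrite mxE !mulr_natl.
by do ![apply: section_OD | apply: section_ON | apply: section_OMn | apply: Os].
Qed.

Section Invariants.
Variables (T : 'I_3 -> 'M[{mpoly k[10 + 3]}]_3) (s : 'rV[{mpoly k[10 + 3]}]_3).
Hypothesis OT : forall l, section_mx 1 0 (T l).
Hypothesis Os : section_mx 0 1 s.

Lemma section_polar_conic : section_mx 2 2 (polar_conic T s).
Proof.
move=> i j; rewrite mxE; apply: section_trace.
have Oc := section_cross Os.
exact (section_mulmx (section_mulmx (section_mulmx (@OT i) Oc) (@OT j)) Oc).
Qed.

Let Oadj : section_mx 4 4 (\adj (polar_conic T s)).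
Proof. exact: section_adj section_polar_conic. Qed.

Lemma section_apolar : section_mx 5 4 (apolar T s).
Proof.
move=> i j; rewrite mxE; apply: section_trace.
exact (section_mulmx Oadj (@OT j)).
Qed.

Lemma section_apolar_pole : section_mx 5 5 (apolar_pole T s).
Proof. exact: (section_mulmx section_apolar (section_cross Os)). Qed.

Lemma section_inv1 : section_O 6 6 (inv1 T s).
Proof. exact: section_det section_polar_conic. Qed.

Lemma section_inv2 : section_O 9 9 (inv2 T s).
Proof.
have O := section_mulmx (section_mulmx Os Oadj) (section_trmx section_apolar).
exact: (@O 0 0).
Qed.

Lemma section_inv3 : section_O 12 12 (inv3 T s).
Proof.
have Op := section_apolar_pole.
have O := section_mulmx (section_mulmx Op section_polar_conic) (section_trmx Op).
exact: (@O 0 0).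
Qed.

Lemma section_inv4 : section_O 36 36 (inv4 T s).
Proof.
have Op := section_apolar_pole.
(* The bidegree is (1, 0) + 3 (5, 5). Twice (16, 15) plus (4, 6), from adj(M)(s, s), is (36, 36):
   the square in [inv4] balances the two degrees. *)
have Otri : section_O 16 15 (tri T (apolar_pole T s) (apolar_pole T s)
                                   (apolar_pole T s)).
  rewrite tri_sumE; do 3 ![apply: section_O_sum => ?].
  have Op3 := section_OM (section_OM (@Op _ _) (@Op _ _)) (@Op _ _).
  exact (section_OM (@OT _ _ _) (@Op3 _ _ _ _ _ _)).
have O := section_mulmx (section_mulmx Os Oadj) (section_trmx Os).
rewrite /inv4 expr2; exact: (section_OM (section_OM Otri Otri) (@O 0 0)).
Qed.

End Invariants.
End Bidegree.

(** * Invariants of pointwise equal tensors *)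

Section EqTensor.
Variables (R : comNzRingType) (T T' : 'I_3 -> 'M[R]_3).
Hypothesis eT : T =1 T'.

Lemma eq_contract w : contract T w = contract T' w.
Proof. by apply: eq_bigr => k _; rewrite eT. Qed.

Lemma eq_tri u v w : tri T u v w = tri T' u v w.
Proof. by rewrite /tri eq_contract. Qed.

Let eq_polar_conic s : polar_conic T s = polar_conic T' s.
Proof. by apply/matrixP=> k l; rewrite !mxE !eT. Qed.

Let eq_apolar s : apolar T s = apolar T' s.
Proof. by apply/rowP=> k; rewrite !mxE eT eq_polar_conic. Qed.

Let eq_apolar_pole s : apolar_pole T s = apolar_pole T' s.
Proof. by rewrite /apolar_pole eq_apolar. Qed.

Lemma eq_inv s : [/\ inv1 T s = inv1 T' s, inv2 T s = inv2 T' s,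
  inv3 T s = inv3 T' s & inv4 T s = inv4 T' s].
Proof.
by rewrite /inv1 /inv2 /inv3 /inv4 !(eq_apolar_pole, eq_apolar, eq_polar_conic,
  eq_tri).
Qed.

End EqTensor.

(** * The trilinear form of a cubic *)

Section Euler.
Variables (n : nat) (R : comNzRingType).
Implicit Types (p : {mpoly R[n]}) (d : nat).

Lemma euler_homog d p : p \is d.-homog -> \sum_i 'X_i * p^`M(i) = p *+ d.
Proof.
move=> /dhomogP hp.
have -> : p *+ d = \sum_(m <- msupp p) p@_m *: 'X_[m] *+ d.
  by rewrite sumrMnl -mpolyE.
under eq_bigr => i _.
  rewrite [p in p^`M(_)]mpolyE raddf_sum mulr_sumr; over.
rewrite exchange_big /= !big_seq; apply: eq_bigr => m /hp <-.
rewrite -[RHS]scaler_nat /= mdegE natr_sum scaler_suml; apply: eq_bigr => i _.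
rewrite mderivZ mderivX -!scalerAr scalerA mulrC -scalerA.
case: (posnP (m i)) => [->|mi_gt0]; first by rewrite !scale0r.
rewrite -mpolyXD addmC submK //; apply/mnm_lepP => j; rewrite mnm1E.
by case: eqP => // <-.
Qed.

Lemma dhomog_mderiv d p i : p \is d.+1.-homog -> p^`M(i) \is d.-homog.
Proof.
move=> /dhomogP hp; apply/dhomogP=> m; rewrite mcoeff_msupp mcoeff_deriv => nz.
have /hp : (m + U_(i))%MM \in msupp p.
  by rewrite mcoeff_msupp; apply: contraNneq nz => ->; rewrite mul0rn.
by rewrite /= mdegD mdeg1 addn1 => -[].
Qed.

Lemma dhomog0E p : p \is 0.-homog -> p = (p@_0%MM)%:MP.
Proof.
move=> hp; apply/mpolyP=> m; rewrite mcoeffC.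
have [->|nz] := eqVneq m 0%MM; first by rewrite mulr1.
by rewrite mulr0 (dhomog_nemf_coeff hp) // mdeg_eq0.
Qed.

Lemma dhomog_comp_mpoly m d p (t : n.-tuple {mpoly R[m]}) :
  p \is d.-homog -> (forall i, tnth t i \is 1.-homog) -> p \mPo t \is d.-homog.
Proof.
move=> /dhomogP hp ht; rewrite comp_mpolyEX big_seq; apply: rpred_sum => u /hp <-.
apply: rpredZ; rewrite /= mdegE.
rewrite comp_mpolyX.
apply: (big_rec2 (fun (q : {mpoly R[m]}) e => q \is e.-homog)) => [|i q e _ hq].
  exact: dhomog1.
by apply: dhomogM => //; have := dhomogMn (u i) (ht i); rewrite mul1n.
Qed.

End Euler.

Section Forms.
Variable R : comNzRingType.
Implicit Types (F S : {mpoly R[3]}).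

(** Third derivatives of a cubic form are constants, read off here as the coefficient of the
    monomial 1. *)
Definition cubic_tensor F k : 'M[R]_3 := \matrix_(i, j) F^`M(k)^`M(j)^`M(i)@_0.

Definition line_row S : 'rV[R]_3 := \row_i S@_(U_(i)).

Definition variables : 'rV[{mpoly R[3]}]_3 := \row_i 'X_i.

Lemma cubic_tensor_sym F : symmetric_tensor (cubic_tensor F).
Proof.
split=> i j k; rewrite !mxE; congr (mcoeff _ _); first exact: mderiv_comm.
by congr (mderiv _ _); apply: mderiv_comm.
Qed.

(** Euler's identity for F, its first and its second derivatives, whence 6 = 3 * 2 * 1. *)
Lemma cubic_tensorE F : F \is 3.-homog ->
  F *+ 6 = tri (map_tensor (@mpolyC 3 R) (cubic_tensor F))
               variables variables variables.
Proof.
move=> hF; rewrite -[6%N]/(3 * (2 * 1))%N mulrnA -(euler_homog hF) -sumrMnl.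
rewrite tri_sumE; apply: eq_bigr => k _; have hk := dhomog_mderiv k hF.
rewrite -mulrnAr mulrnA -(euler_homog hk) -sumrMnl mulr_sumr.
apply: eq_bigr => j _; have hj := dhomog_mderiv j hk.
rewrite -mulrnAr -(euler_homog hj) !mulr_sumr.
apply: eq_bigr => i _; rewrite /map_tensor !mxE /= -dhomog0E; last first.
  exact: dhomog_mderiv.
ring.
Qed.

(** Evaluation at a point over an extension of the ring: constants for values, multivariate
    polynomials for local equations, polynomials in t for restrictions to lines. *)
Lemma cubic_tensor_morph (R' : comNzRingType) (f : {rmorphism R -> R'})
    (x : 'rV[R']_3) F : F \is 3.-homog ->
  mmap f (fun i => x 0 i) F *+ 6 =
    tri (map_tensor f (cubic_tensor F)) x x x.
Proof.
move=> hF; rewrite -mmapMn cubic_tensorE // map_tri.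
have -> : map_mx (mmap f (fun i => x 0 i)) variables = x.
  by apply/rowP=> i; rewrite !mxE mmapX mmap1U.
by apply: eq_tri => k; apply/matrixP=> i j; rewrite /map_tensor !mxE /= mmapC.
Qed.

Lemma line_rowE S : S \is 1.-homog -> S = \sum_i (line_row S 0 i)%:MP * 'X_i.
Proof.
move=> hS; rewrite -[LHS]mulr1n -(euler_homog hS); apply: eq_bigr => i _.
by rewrite mulrC [S^`M(i)]dhomog0E ?dhomog_mderiv // mcoeff_deriv add0m mxE mnm0E.
Qed.

Lemma line_row_eval S (p : 'rV[R]_3) : S \is 1.-homog ->
  S.@[fun i => p 0 i] = (line_row S *m p^T) 0 0.
Proof.
move=> hS; rewrite [S in LHS]line_rowE // raddf_sum mxE; apply: eq_bigr => i _.
by rewrite /= mevalM mevalC mevalXU [p^T _ _]mxE.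
Qed.

End Forms.

(** * Semistability from a nonvanishing invariant *)

Section Semistability.
Variable k : closedFieldType.
Hypothesis nz6 : 6 != 0 :> k.
Implicit Types (F S : {mpoly k[3]}) (g h : 'M[k]_3).

Lemma cubic_tensor_eval F (p : 'rV[k]_3) : is_form 3 F ->
  6 * F.@[fun i => p 0 i] = tri (cubic_tensor F) p p p.
Proof.
move=> hF; have := cubic_tensor_morph (@idfun k) p hF.
rewrite -mulr_natl => ->; apply: eq_tri => l.
exact: map_mx_id.
Qed.

Lemma on_curve_tri F p : is_form 3 F ->
  on_curve F p <-> tri (cubic_tensor F) p p p = 0.
Proof.
move=> hF; rewrite -cubic_tensor_eval // /on_curve; split=> [-> | /eqP].
  by rewrite mulr0.
by rewrite mulf_eq0 (negPf nz6) => /eqP.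
Qed.

(** Polarization, 6 being invertible. It reduces the action of g on tensors to a comparison of
    values. *)
Lemma tri_inj (T T' : 'I_3 -> 'M[k]_3) : symmetric_tensor T -> symmetric_tensor T' ->
  (forall x, tri T x x x = tri T' x x x) -> T =1 T'.
Proof.
move=> sT sT' eT l; apply/matrixP=> i j; apply: (mulfI nz6).
by rewrite -[T l i j]tri_delta -[T' l i j]tri_delta !polarization // !eT.
Qed.

Lemma act_homog d g F : is_form d F -> is_form d (act g F).
Proof.
move=> hF; apply: dhomog_comp_mpoly hF _ => i; rewrite tnth_mktuple.
by apply: rpred_sum => j _; apply: rpredZ; rewrite /= dhomogX /= mdeg1.
Qed.

Lemma act_eval g F (p : 'rV[k]_3) :
  (act g F).@[fun i => p 0 i] = F.@[fun i => (p *m (invmx g)^T) 0 i].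
Proof.
rewrite comp_mpoly_meval; apply: meval_eq => i; rewrite tnth_mktuple raddf_sum.
rewrite mxE; apply: eq_bigr => j _; rewrite /= mevalZ mevalXU !mxE.
by rewrite mulrC.
Qed.

Lemma cubic_tensor_act g F : is_form 3 F ->
  cubic_tensor (act g F) =1 pullback (invmx g) (cubic_tensor F).
Proof.
move=> hF; have sF := cubic_tensor_sym F; apply: tri_inj.
- exact: cubic_tensor_sym.
- exact: pullback_sym.
move=> x; rewrite tri_pullback -!cubic_tensor_eval //; first by rewrite act_eval.
exact: act_homog.
Qed.

Lemma line_row_act g S : is_form 1 S ->
  line_row (act g S) = line_row S *m invmx g.
Proof.
move=> hS; apply/rowP=> j.
have evalU S' : is_form 1 S' ->
    line_row S' 0 j = S'.@[fun i => (delta_mx 0 j : 'rV[k]_3) 0 i].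
  by move=> hS'; rewrite line_row_eval // trmx_delta -colE [RHS]mxE.
rewrite evalU; last exact: act_homog.
rewrite act_eval line_row_eval // trmx_mul trmxK trmx_delta.
by rewrite mulmxA -colE [LHS]mxE.
Qed.

Lemma cubic_exponentsP (i j l : 'I_3) :
  (U_(i) + U_(j) + U_(l))%MM \in cubic_exponents.
Proof.
have mE (m : 'X_{1..3}) : m = [multinom of [:: m i0; m i1; m i2]].
  apply/mnmP; apply: ord3P; rewrite [RHS](mnm_nth 0%N) /=; rewrite inordK //.
rewrite [X in X \in _]mE !mnmDE !mnm1E.
by move: i j l; do 3 ![apply: ord3P]; rewrite !(ord3E, eqxx) /= !inE ?eqxx ?orbT.
Qed.

(** The tensor of the generic cubic, over the coordinate ring of P^9 x P^2. The integer factors are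
    those produced by differentiating x_i x_j x_l along l, then j, then i. *)
Definition coord_tensor (l : 'I_3) : 'M[{mpoly k[10 + 3]}]_3 := \matrix_(i, j)
  ('X_(lshift 3 (inord (index (U_(i) + U_(j) + U_(l))%MM cubic_exponents)))
   *+ ((U_(i) + U_(j))%MM l).+1 *+ (U_(i)%MM j).+1).

Definition coord_line : 'rV[{mpoly k[10 + 3]}]_3 := \row_i 'X_(rshift 10 i).

Lemma coord_tensor_eval F S l :
  map_mx (meval (coords F S)) (coord_tensor l) = cubic_tensor F l.
Proof.
apply/matrixP=> i j; rewrite !mxE !mcoeff_deriv add0m mnm0E mulr1n.
have := cubic_exponentsP i j l; set m := (_ + _ + _)%MM => mC.
rewrite rmorphMn rmorphMn; congr (_ *+ _ *+ _).
have lt_m : (index m cubic_exponents < 10)%N.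
  by have := mC; rewrite -index_mem size_tuple.
rewrite [LHS]mevalXU /coords (unsplitK (inl _)) (tnth_nth 0%MM) inordK //.
by rewrite nth_index.
Qed.

Lemma coord_line_eval F S :
  map_mx (meval (coords F S)) coord_line = line_row S.
Proof.
by apply/rowP=> i; rewrite !mxE /= mevalXU /coords (unsplitK (inr _)).
Qed.

Lemma section_coord_tensor l : section_mx 1 0 (coord_tensor l).
Proof.
move=> i j; rewrite mxE; do 2 apply: section_OMn; move: (inord _) => a m.
rewrite msuppX inE => /eqP->; split.
  rewrite (bigD1 a) //= mnm1E eqxx big1 ?addn0 // => b /negPf nab.
  by rewrite mnm1E (inj_eq (@lshift_inj _ _)) eq_sym nab.
by rewrite big1 // => b _; rewrite mnm1E eq_lrshift.
Qed.

Lemma section_coord_line : section_mx 0 1 coord_line.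
Proof.
move=> ? a m; rewrite mxE msuppX inE => /eqP->; split.
  by rewrite big1 // => b _; rewrite mnm1E eq_rlshift.
rewrite (bigD1 a) //= mnm1E eqxx big1 ?addn0 // => b /negPf nab.
by rewrite mnm1E (inj_eq (@rshift_inj _ _)) eq_sym nab.
Qed.

(* An invariant is a polynomial expression I in the tensor of F and the row of
   coefficients of S, given over all commutative rings at once. *)
Lemma semistable_of_invariant (d : nat)
    (I : forall R : comNzRingType, ('I_3 -> 'M[R]_3) -> 'rV[R]_3 -> R) F S :
    (0 < d)%N ->
    (forall (R R' : comNzRingType) (f : {rmorphism R -> R'}) T s,
       f (I R T s) = I R' (map_tensor f T) (map_mx f s)) ->
    (forall T s, (forall l, section_mx 1 0 (T l)) -> section_mx 0 1 s ->
       section_O d d (I {mpoly k[10 + 3]} T s)) ->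
    (forall T T' s, T =1 T' -> I k T s = I k T' s) ->
    (forall h T s, \det h = 1 -> I k (pullback h T) (s *m h) = I k T s) ->
    is_form 3 F -> is_form 1 S ->
  I k (cubic_tensor F) (line_row S) != 0 -> semistable F S.
Proof.
move=> d_gt0 I_nat I_deg I_ext I_inv hF hS nzI.
(* The invariant section is I at the generic cubic and line; by naturality, evaluating it
   specializes the generic tensor. *)
have evalI F' S' : (I _ coord_tensor coord_line).@[coords F' S'] =
    I k (cubic_tensor F') (line_row S').
  rewrite I_nat coord_line_eval; apply: I_ext => l.
  exact: coord_tensor_eval.
exists d, (I _ coord_tensor coord_line); split=> //.
- exact: I_deg section_coord_tensor section_coord_line.
- move=> g F' S' detg hF' hS'; rewrite !evalI line_row_act //.
  rewrite (I_ext _ _ _ (cubic_tensor_act g hF')) I_inv //.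
  by rewrite det_inv detg invr1.
- by rewrite evalI.
Qed.

Lemma semistable_inv F S : is_form 3 F -> is_form 1 S ->
  let T := cubic_tensor F in let s := line_row S in
  [|| inv1 T s != 0, inv2 T s != 0, inv3 T s != 0 | inv4 T s != 0] ->
  semistable F S.
Proof.
move=> hF hS T s /or4P[].
- apply: (@semistable_of_invariant 6 (@inv1)) => //.
  + exact: map_inv1.
  + exact: section_inv1.
  + by move=> ? ? x /eq_inv/(_ x)[].
  + by move=> *; apply: inv1_pullback.
- apply: (@semistable_of_invariant 9 (@inv2)) => //.
  + exact: map_inv2.
  + exact: section_inv2.
  + by move=> ? ? x /eq_inv/(_ x)[].
  + by move=> *; apply: inv2_pullback.
- apply: (@semistable_of_invariant 12 (@inv3)) => //.
  + exact: map_inv3.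
  + exact: section_inv3.
  + by move=> ? ? x /eq_inv/(_ x)[].
  + by move=> *; apply: inv3_pullback.
- apply: (@semistable_of_invariant 36 (@inv4)) => //.
  + exact: map_inv4.
  + exact: section_inv4.
  + by move=> ? ? x /eq_inv/(_ x)[].
  + by move=> *; apply: inv4_pullback.
Qed.

End Semistability.

(** * Values of the invariants in adapted coordinates *)

Section NormalForms.
Variable k : fieldType.
Variables (T : 'I_3 -> 'M[k]_3) (s : 'rV[k]_3).
Hypotheses (sT : symmetric_tensor T) (s0 : s 0 i0 = 0) (s1 : s 0 i1 = 0).

(** Rewriting to the representative [T l i j] with i <= j <= l, so that [ring] sees one name per
    coefficient. *)
Let sortT : (T i0 i0 i1 = T i1 i0 i0) * (T i0 i0 i2 = T i2 i0 i0) *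
  (T i0 i1 i0 = T i1 i0 i0) * (T i0 i1 i1 = T i1 i0 i1) *
  (T i0 i1 i2 = T i2 i0 i1) * (T i0 i2 i0 = T i2 i0 i0) *
  (T i0 i2 i1 = T i2 i0 i1) * (T i0 i2 i2 = T i2 i0 i2) *
  (T i1 i0 i2 = T i2 i0 i1) * (T i1 i1 i0 = T i1 i0 i1) *
  (T i1 i1 i2 = T i2 i1 i1) * (T i1 i2 i0 = T i2 i0 i1) *
  (T i1 i2 i1 = T i2 i1 i1) * (T i1 i2 i2 = T i2 i1 i2) *
  (T i2 i1 i0 = T i2 i0 i1) * (T i2 i2 i0 = T i2 i0 i2) *
  (T i2 i2 i1 = T i2 i1 i2).
Proof.
have [sym12 sym23] := sT.
have sym13 i j l : T l i j = T i l j by rewrite sym12 sym23 sym12.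
do !split; first [exact: sym12 | exact: sym13 | exact: sym23
  | by rewrite sym12 sym13 | by rewrite sym13 sym12].
Qed.

(** As L is z = 0, only the x, y blocks of the slices matter, and their determinant is polarized. *)
Let polar_conicE i j : polar_conic T s i j = - s 0 i2 ^+ 2 *
  (T i i0 i0 * T j i1 i1 + T i i1 i1 * T j i0 i0 - 2 * T i i0 i1 * T j i0 i1).
Proof.
have [sym12 _] := sT.
have crossE : (cross s i0 i1 = s 0 i2) * (cross s i1 i0 = - s 0 i2)
    * (cross s i0 i0 = 0) * (cross s i1 i1 = 0) * (forall i, cross s i i2 = 0)
    * (forall i, cross s i2 i = 0).
  do !split; try (move=> {i j} i); rewrite mxE s0 s1 !(ord3E, eqxx) ?andbF /=; ring.
rewrite mxE; move: (cross s) crossE => c crossE.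
rewrite /mxtrace !sum3E !mxE !sum3E !mxE !sum3E !mxE !sum3E !crossE.
by rewrite [T i i1 i0]sym12 [T j i1 i0]sym12; ring.
Qed.

(** The first row of M is (0, 0, M02), so det M = - M02^2 M11. *)
Lemma inv1_double_root : T i0 i0 i0 = 0 -> T i1 i0 i0 = 0 ->
  inv1 T s = - 2 * s 0 i2 ^+ 6 * T i1 i0 i1 ^+ 4 * T i2 i0 i0 ^+ 2.
Proof.
by move=> T000 T001; rewrite /inv1 det3E !polar_conicE !sortT T000 T001; ring.
Qed.

Hypotheses (T001 : T i1 i0 i0 = 0) (T011 : T i1 i0 i1 = 0).
Hypotheses (T002 : T i2 i0 i0 = 0) (T112 : T i2 i1 i1 = 0).

Let m := - s 0 i2 ^+ 2 * T i0 i0 i0 * T i1 i1 i1.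

(** In the normal form a x^3 + d y^3 + ..., without the terms x^2 z and y^2 z, the quadratic form M
    has only the monomials x y and z^2. *)
Let polar_conic_diag : (polar_conic T s i0 i0 = 0) * (polar_conic T s i0 i1 = m)
  * (polar_conic T s i0 i2 = 0) * (polar_conic T s i1 i0 = m)
  * (polar_conic T s i1 i1 = 0) * (polar_conic T s i1 i2 = 0)
  * (polar_conic T s i2 i0 = 0) * (polar_conic T s i2 i1 = 0)
  * (polar_conic T s i2 i2 = 2 * (s 0 i2 * T i2 i0 i1) ^+ 2).
Proof.
by do !split; rewrite polar_conicE ?sortT ?T001 ?T011 ?T002 ?T112 /m; ring.
Qed.

Lemma inv1_distinct_roots :
  inv1 T s = - 2 * m ^+ 2 * (s 0 i2 * T i2 i0 i1) ^+ 2.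
Proof. by rewrite /inv1 det3E !polar_conic_diag; ring. Qed.

Hypothesis T012 : T i2 i0 i1 = 0.

(** M is now 2 m x y, and its dual is concentrated at the vertex (0 : 0 : 1). Hence w is a multiple
    of T(., e_2, e_2), the polar line of that point. *)
Let adjE i j : \adj (polar_conic T s) i j = - (m ^+ 2) * ((i == i2) && (j == i2))%:R.
Proof.
move: i j; apply: ord3P; apply: ord3P; rewrite adj3E !polar_conic_diag
  ?T012 !(ord3E, eqxx) /=; ring.
Qed.

Let apolarE i : apolar T s 0 i = - m ^+ 2 * T i i2 i2.
Proof.
by rewrite mxE /mxtrace sum3E !mxE !sum3E !adjE !(ord3E, eqxx) /=; ring.
Qed.

Let poleE : (apolar_pole T s 0 i0 = m ^+ 2 * s 0 i2 * T i2 i1 i2)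
  * (apolar_pole T s 0 i1 = - m ^+ 2 * s 0 i2 * T i2 i0 i2)
  * (apolar_pole T s 0 i2 = 0).
Proof.
by do !split; rewrite /apolar_pole mxE sum3E !apolarE !mxE s0 s1 ?sortT
  !(ord3E, eqxx) /=; ring.
Qed.

Lemma inv2_distinct_roots : inv2 T s = s 0 i2 * m ^+ 4 * T i2 i2 i2.
Proof.
rewrite /inv2 mxE sum3E ![_^T _ _]mxE !apolarE !mxE !sum3E !adjE.
by rewrite s0 s1 !(ord3E, eqxx) /=; ring.
Qed.

Lemma inv3_distinct_roots :
  inv3 T s = - 2 * m ^+ 5 * s 0 i2 ^+ 2 * T i2 i0 i2 * T i2 i1 i2.
Proof.
rewrite /inv3 mxE sum3E ![(_ *m polar_conic T s) _ _]mxE !sum3E.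
by rewrite ![_^T _ _]mxE !poleE !polar_conic_diag; ring.
Qed.

(** The pole lies on L, where F is a sum of two cubes, so T(p, p, p) has only two terms. *)
Lemma inv4_distinct_roots : inv4 T s = - (m ^+ 2 * s 0 i2 ^+ 2) *
  (m ^+ 6 * s 0 i2 ^+ 3 * (T i0 i0 i0 * T i2 i1 i2 ^+ 3
                           - T i1 i1 i1 * T i2 i0 i2 ^+ 3)) ^+ 2.
Proof.
rewrite /inv4 tri_sumE !sum3E !poleE !sortT T001 T011 mxE sum3E !mxE !sum3E !adjE.
by rewrite s0 s1 !(ord3E, eqxx) /=; ring.
Qed.

End NormalForms.

(** * Bases adapted to a point and a line *)

Section Frames.
Variable k : fieldType.
Implicit Types (s p q r u v w : 'rV[k]_3) (T : 'I_3 -> 'M[k]_3).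

Definition dot s p : k := (s *m p^T) 0 0.

Lemma dotDr s u v : dot s (u + v) = dot s u + dot s v.
Proof. by rewrite /dot linearD mulmxDr mxE. Qed.

Lemma dotZr s a u : dot s (a *: u) = a * dot s u.
Proof. by rewrite /dot linearZ -scalemxAr mxE. Qed.

Lemma dot_delta s i : dot s (delta_mx 0 i) = s 0 i.
Proof. by rewrite /dot trmx_delta -colE mxE. Qed.

Lemma dotC s p : dot s p = dot p s.
Proof. by rewrite /dot !mxE; apply: eq_bigr => i _; rewrite !mxE mulrC. Qed.

Definition frame p q r : 'M[k]_3 :=
  \matrix_(i, j) (if j == i0 then p 0 i else if j == i1 then q 0 i else r 0 i).

Lemma row_frame p q r :
  (row i0 (frame p q r)^T = p) * (row i1 (frame p q r)^T = q) *
  (row i2 (frame p q r)^T = r).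
Proof. by do !split; apply/rowP=> i; rewrite !mxE !(ord3E, eqxx). Qed.

Lemma mulmx_frame s p q r :
  ((s *m frame p q r) 0 i0 = dot s p) * ((s *m frame p q r) 0 i1 = dot s q) *
  ((s *m frame p q r) 0 i2 = dot s r).
Proof.
by do !split; rewrite /dot !mxE; apply: eq_bigr => i _;
   rewrite !mxE !(ord3E, eqxx).
Qed.

Lemma det_frameE p q r :
  \det (frame p q r) = p 0 i0 * (q 0 i1 * r 0 i2 - q 0 i2 * r 0 i1)
    + p 0 i1 * (q 0 i2 * r 0 i0 - q 0 i0 * r 0 i2)
    + p 0 i2 * (q 0 i0 * r 0 i1 - q 0 i1 * r 0 i0).
Proof. by rewrite det3E !mxE !(ord3E, eqxx); ring. Qed.

(** The identity (s x n) x r = (s . r) n - (n . r) s, paired with p. *)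
Lemma det_frame_cross p n s r :
  \det (frame p (n *m cross s) r) = dot p n * dot s r - dot p s * dot n r.
Proof.
by rewrite det_frameE /dot !mxE !sum3E !mxE !(ord3E, eqxx) /=; ring.
Qed.

Lemma dot_cross s n : dot s (n *m cross s) = 0.
Proof. by rewrite /dot !mxE !sum3E !mxE !sum3E !mxE !(ord3E, eqxx) /=; ring. Qed.

Lemma exists_dot1 p : p != 0 -> exists n, dot p n = 1.
Proof.
case/rV0Pn=> i pi_neq0; exists ((p 0 i)^-1 *: delta_mx 0 i).
by rewrite dotZr dot_delta mulVf.
Qed.

(** With s . r = 1 and p . n = 1, the vector q = s x n lies on L, and the previous determinant
    equals 1. *)
Lemma line_frame s p : s != 0 -> p != 0 -> dot s p = 0 ->
  exists q r, dot s q = 0 /\ \det (frame p q r) = 1.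
Proof.
move=> /exists_dot1[r sr] /exists_dot1[n pn] sp; exists (n *m cross s), r.
by split; [exact: dot_cross | rewrite det_frame_cross pn sr dotC sp; ring].
Qed.

Lemma exists_point_on_line s : exists2 p, p != 0 & dot s p = 0.
Proof.
have nz_delta i : delta_mx 0 i != 0 :> 'rV[k]_3.
  by apply/rV0Pn; exists i; rewrite mxE !eqxx oner_neq0.
have [s0|nz] := eqVneq (s 0 i0) 0.
  by exists (delta_mx 0 i0); rewrite ?nz_delta // dot_delta.
exists (- s 0 i1 *: delta_mx 0 i0 + s 0 i0 *: delta_mx 0 i1).
  by apply/rV0Pn; exists i1; rewrite !mxE !(ord3E, eqxx) mulr0 mulr1 add0r.
by rewrite dotDr !dotZr !dot_delta mulNr mulrC addNr.
Qed.

Lemma point_frame p : p != 0 -> exists q r, \det (frame p q r) = 1.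
Proof.
(* By duality, a line s through p is a point of the line with coefficients p. *)
move=> nzp; have [s nzs ps] := exists_point_on_line p.
by have [|q [r [_ detF]]] := line_frame nzs nzp; [rewrite dotC | exists q, r].
Qed.

Lemma frame_basis p q r v : \det (frame p q r) = 1 ->
  exists a b c, v = a *: p + b *: q + c *: r.
Proof.
move=> det1; pose w := v *m (invmx (frame p q r))^T.
exists (w 0 i0), (w 0 i1), (w 0 i2).
have unitF : frame p q r \in unitmx by rewrite unitmxE det1 unitr1.
have -> : v = w *m (frame p q r)^T.
  by rewrite /w -mulmxA -trmx_mul mulmxV // trmx1 mulmx1.
by rewrite mulmx_sum_row sum3E !row_frame.
Qed.

Lemma dot_frame_neq0 s p q r : s != 0 -> \det (frame p q r) = 1 ->
  dot s p = 0 -> dot s q = 0 -> dot s r != 0.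
Proof.
move=> nzs det1 sp sq; apply: contra_neq nzs => sr; apply/rowP=> i.
have [a [b [c e]]] := frame_basis (delta_mx 0 i) det1.
by rewrite -[LHS]dot_delta e !dotDr !dotZr sp sq sr !mulr0 !addr0 mxE.
Qed.

Lemma frame_indep p q r a b : \det (frame p q r) = 1 ->
  a *: p + b *: q = 0 -> a = 0 /\ b = 0.
Proof.
move=> det1 e.
have unitF : frame p q r \in unitmx by rewrite unitmxE det1 unitr1.
pose w : 'rV[k]_3 := \row_i (if i == i0 then a else if i == i1 then b else 0).
suff /rowP w0 : w = 0.
  by have := w0 i0; have := w0 i1; rewrite !mxE !(ord3E, eqxx).
have : w *m (frame p q r)^T = 0.
  by rewrite mulmx_sum_row sum3E !row_frame !mxE !(ord3E, eqxx) scale0r addr0.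
move=> /(congr1 (fun x => x *m (invmx (frame p q r))^T)).
by rewrite -mulmxA -trmx_mul mulVmx // trmx1 mulmx1 mul0mx.
Qed.

Lemma line_span s p q r v : s != 0 -> \det (frame p q r) = 1 ->
  dot s p = 0 -> dot s q = 0 -> dot s v = 0 -> exists a b, v = a *: p + b *: q.
Proof.
move=> nzs det1 sp sq; have [a [b [c ->]]] := frame_basis v det1.
rewrite !dotDr !dotZr sp sq !mulr0 !add0r => /eqP.
rewrite mulf_eq0 (negPf (dot_frame_neq0 nzs det1 sp sq)) orbF => /eqP->.
by exists a, b; rewrite scale0r addr0.
Qed.

Lemma frame_neq0 p q r : \det (frame p q r) = 1 -> p != 0 /\ q != 0.
Proof.
move=> det1; split; apply: contra_eq_neq det1 => ->; rewrite det_frameE !mxE.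
  by rewrite !mul0r !addr0 eq_sym oner_neq0.
by rewrite !mul0r !subr0 !mulr0 !addr0 eq_sym oner_neq0.
Qed.

Lemma lines_meet s t : exists p, [/\ p != 0, dot s p = 0 & dot t p = 0].
Proof.
have [p nzp sp] := exists_point_on_line s.
have [->|nzs] := eqVneq s 0.
  have [q nzq tq] := exists_point_on_line t.
  by exists q; rewrite /dot mul0mx mxE.
have [q [r [sq det1]]] := line_frame nzs nzp sp.
have [tp|tp] := eqVneq (dot t p) 0; first by exists p.
(* The combination of p and q killed by t; it is nonzero because t does not vanish at p. *)
exists (dot t q *: p - dot t p *: q); split.
- apply: contra_neq tp; rewrite -scaleNr => /(frame_indep det1)[_ /eqP].
  by rewrite oppr_eq0 => /eqP.
- by rewrite -scaleNr dotDr !dotZr sp sq !mulr0 addr0.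
- by rewrite -scaleNr dotDr !dotZr; ring.
Qed.

End Frames.

(** * Multiplicities of points and of intersections *)

Section Multiplicity.
Variable k : closedFieldType.
Hypotheses (nz2 : 2 != 0 :> k) (nz3 : 3 != 0 :> k).
Variables (F : {mpoly k[3]}).
Hypotheses (hF : is_form 3 F) (nzF : F != 0).

Let nz6 : 6 != 0 :> k.
Proof. by rewrite (_ : 6 = 2 * 3) ?mulf_neq0 //; ring. Qed.

Let T := cubic_tensor F.
Let sT : symmetric_tensor T := cubic_tensor_sym F.

Lemma tri_cubic_tensor_eq0 : (forall x, tri T x x x = 0) -> F = 0.
Proof.
pose O (R : comNzRingType) (l : 'I_3) : 'M[R]_3 := 0.
have triO (R : comNzRingType) u v w : tri (@O R) u v w = 0.
  by rewrite tri_sumE; do 3 ![rewrite big1 // => ? _]; rewrite mxE mul0r.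
move=> T0; have eT : T =1 @O k.
  apply: (tri_inj nz6) => // [|x]; last by rewrite T0 triO.
  by split=> ? ? ?; rewrite !mxE.
have : F *+ 6 = 0.
  rewrite cubic_tensorE // (eq_tri (T' := @O _)) ?triO // => l.
  by rewrite /map_tensor -/T eT map_mx0.
rewrite -scaler_nat => /eqP; rewrite scaler_eq0 (negPf nz6) /=.
by move/eqP.
Qed.

Section OrderOfParts.
Variables (f : {mpoly k[3]}) (part : nat -> {mpoly k[3]}).
Hypothesis hpart : forall d, (d <= 3)%N -> part d \is d.-homog.
Hypothesis fE : f *+ 6 = part 0 + part 1 *+ 3 + part 2 *+ 3 + part 3.

Let coef_part d m : (d <= 3)%N -> mdeg m != d -> (part d)@_m = 0.
Proof. by move=> led; apply: dhomog_nemf_coeff; apply: hpart. Qed.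

Let coef_local m : (f)@_m * 6 =
  (part 0)@_m + (part 1)@_m *+ 3 + (part 2)@_m *+ 3 + (part 3)@_m.
Proof.
have /(congr1 (mcoeff m)) := fE.
by rewrite !(mcoeffD, mcoeffMn) mulr_natr.
Qed.

(** In degree d only [part d] contributes, with a factor 1 or 3; both 3 and 6 are invertible. *)
Let coef_local_part m d : (d <= 3)%N -> mdeg m = d ->
  ((f)@_m == 0) = ((part d)@_m == 0).
Proof.
move=> led degm; rewrite -(inj_eq (mulIf nz6)) mul0r coef_local.
case: d led degm => [|[|[|[|//]]]] _ degm.
- by rewrite (@coef_part 1 m) ?(@coef_part 2 m) ?(@coef_part 3 m) ?degm //
             !mul0rn !addr0.
- rewrite (@coef_part 0 m) ?(@coef_part 2 m) ?(@coef_part 3 m) ?degm //.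
  by rewrite mul0rn !addr0 add0r -mulr_natr mulf_eq0 (negPf nz3) orbF.
- rewrite (@coef_part 0 m) ?(@coef_part 1 m) ?(@coef_part 3 m) ?degm //.
  by rewrite mul0rn !addr0 !add0r -mulr_natr mulf_eq0 (negPf nz3) orbF.
- by rewrite (@coef_part 0 m) ?(@coef_part 1 m) ?(@coef_part 2 m) ?degm //
             !mul0rn !add0r.
Qed.

Lemma order_of_parts r : (r <= 3)%N ->
  order_at_origin (f) r <->
  (forall d, (d < r)%N -> part d = 0) /\ part r != 0.
Proof.
move=> ler; split=> [[low [m nzm degm]] | [low nzr]].
  split=> [d ltd|].
    have led : (d <= 3)%N := ltnW (leq_trans ltd ler).
    apply/mpolyP=> m'; rewrite mcoeff0.
    have [degm'|] := eqVneq (mdeg m') d; last exact: coef_part.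
    apply/eqP; rewrite -(coef_local_part led degm'); apply: contraTT ltd => /low.
    by rewrite degm' leqNgt.
  apply: contraNneq nzm => partr; rewrite (coef_local_part ler degm) partr.
  by rewrite mcoeff0.
split=> [m nzm|].
  rewrite leqNgt; apply: contra nzm => ltm.
  rewrite (@coef_local_part _ (mdeg m)) ?low ?mcoeff0 //.
  exact: ltnW (leq_trans ltm ler).
exists (mlead (part r)); last first.
  by apply: (dhomog_mf (hpart ler)); rewrite mlead_supp.
rewrite (@coef_local_part _ r) // -?mcoeff_msupp ?mlead_supp //.
by apply: (dhomog_mf (hpart ler)); rewrite mlead_supp.
Qed.

End OrderOfParts.

Section LocalEquation.
Variables (p y : 'rV[k]_3) (i : 'I_3).
Hypotheses (pi_neq0 : p 0 i != 0) (yi : y 0 i = 1) (py : p = p 0 i *: y).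

(** The generic displacement in the chart: the local equation at p is F(y + X), y being p scaled to
    have i-th coordinate 1. *)
Let X : 'rV[{mpoly k[3]}]_3 := \row_j (if j == i then 0 else 'X_j).
Let Tm := map_tensor (@mpolyC 3 k) T.
Let Y : 'rV[{mpoly k[3]}]_3 := map_mx (@mpolyC 3 k) y.

Let away (v : 'rV[k]_3) : exists2 v' : 'rV[k]_3, v' 0 i = 0 & v = v 0 i *: y + v'.
Proof.
by exists (v - v 0 i *: y); rewrite ?subrKC // !mxE yi mulr1 subrr.
Qed.

Let homogX j : X 0 j \is 1.-homog.
Proof.
by rewrite mxE; case: eqP => _; rewrite ?dhomog0 // dhomogX /= mdeg1.
Qed.

Let homogC (c : k) : c%:MP_[3] \is 0.-homog.
Proof. by rewrite -[c%:MP]mulr1 mul_mpolyC dhomogZ ?dhomog1. Qed.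

(** The successive terms T(y, y, y), T(y, y, X), T(y, X, X), T(X, X, X) of the Taylor expansion at
    y. *)
Let part (d : nat) := tri Tm (if (d < 3)%N then Y else X)
   (if (d < 2)%N then Y else X) (if (d < 1)%N then Y else X).

Let homog_part d : (d <= 3)%N -> part d \is d.-homog.
Proof.
have hZ j : (Y 0 j) \is 0.-homog by rewrite mxE homogC.
have hT a b c : Tm c a b \is 0.-homog by rewrite /Tm /map_tensor mxE homogC.
have hM (t u v w : {mpoly k[3]}) d1 d2 d3 : t \is 0.-homog ->
    u \is d1.-homog -> v \is d2.-homog -> w \is d3.-homog ->
    t * (u * v * w) \is (d1 + d2 + d3).-homog.
  by move=> ht hu hv hw; rewrite -[(d1 + d2 + d3)%N]add0n !dhomogM.
rewrite /part tri_sumE.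
case: d => [|[|[|[|//]]]] _ /=; do 3 ![apply: rpred_sum => ? _].
- exact: (hM _ _ _ _ 0 0 0)%N.
- exact: (hM _ _ _ _ 0 0 1)%N.
- exact: (hM _ _ _ _ 0 1 1)%N.
- exact: (hM _ _ _ _ 1 1 1)%N.
Qed.

Let sTm : symmetric_tensor Tm.
Proof.
by case: sT => s12 s23; split=> a b c;
   rewrite /Tm /map_tensor [LHS]mxE [RHS]mxE; congr _%:MP.
Qed.

Let local_equationE : local_equation F p i *+ 6 =
  part 0 + part 1 *+ 3 + part 2 *+ 3 + part 3.
Proof.
have -> : local_equation F p i = mmap (@mpolyC 3 k) (fun j => (Y + X) 0 j) F.
  apply: eq_bigr => m _; congr (_ * _); apply: mmap1_eq => j.
  rewrite tnth_mktuple !mxE; case: eqP => [->|_]; first by rewrite yi addr0.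
  by rewrite addrC [in p 0 j]py mxE mulrAC divff // mul1r.
rewrite (cubic_tensor_morph (@mpolyC 3 k) (Y + X) hF) -/Tm /part /= !triE.
have [-> ->] : tri Tm Y X Y = tri Tm Y Y X /\ tri Tm X Y Y = tri Tm Y Y X.
  by split; [apply: tri_sym23 | apply: tri_sym13].
have [-> ->] : tri Tm X Y X = tri Tm Y X X /\ tri Tm X X Y = tri Tm Y X X.
  by split; [apply: tri_sym12 | apply: tri_sym13].
move: (tri Tm Y Y Y) (tri Tm Y Y X) (tri Tm Y X X) (tri Tm X X X) => a b c d.
ring.
Qed.

Let local_order r : (r <= 3)%N ->
  order_at_origin (local_equation F p i) r <->
  (forall d, (d < r)%N -> part d = 0) /\ part r != 0.
Proof. exact: (order_of_parts homog_part local_equationE). Qed.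

Let part_eval d (v : 'rV[k]_3) : v 0 i = 0 ->
  (part d).@[fun j => v 0 j] = tri T (if (d < 3)%N then y else v)
   (if (d < 2)%N then y else v) (if (d < 1)%N then y else v).
Proof.
move=> vi; have mX : map_mx (meval (fun j => v 0 j)) X = v.
  apply/rowP=> j; rewrite !mxE /=; case: eqP => [->|_]; last exact: mevalXU.
  by rewrite meval0 vi.
have mY : map_mx (meval (fun j => v 0 j)) Y = y.
  by apply/rowP=> j; rewrite [LHS]mxE [Y _ _]mxE /= mevalC.
have mT : map_tensor (meval (fun j => v 0 j)) Tm =1 T.
  move=> l; apply/matrixP=> a b; rewrite /map_tensor [LHS]mxE.
  by rewrite /Tm /map_tensor [map_mx _ _ _ _]mxE /= mevalC.
by rewrite /part; case: d => [|[|[|d]]] /=; rewrite map_tri ?mX ?mY (eq_tri mT).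
Qed.

Let contract_Tm : contract Tm Y = map_mx (@mpolyC 3 k) (contract T y).
Proof. by rewrite map_contract. Qed.

(** Every vector is a multiple of y plus a displacement in the chart; the two parts test T(y, y, .)
    on the two summands. *)
Let part_eq0_1 : part 0 = 0 /\ part 1 = 0 <-> forall v, tri T y y v = 0.
Proof.
split=> [[part0 part1] v|yy].
  have [v' v'i ->] := away v; rewrite triDr triZr.
  have := part_eval 1 v'i; rewrite part1 meval0 /= => <-.
  have := part_eval 0 v'i; rewrite part0 meval0 /= => <-.
  by rewrite mulr0 addr0.
have YY A : tri Tm Y Y A = 0.
  rewrite tri_sym13 // /tri -mulmxA contract_Tm map_trmx -map_mxM.
  suff -> : contract T y *m y^T = 0 by rewrite map_mx0 mulmx0 mxE.
  apply/colP=> a; rewrite [RHS]mxE -(yy (delta_mx 0 a)) (tri_sym13 y) // /tri.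
  by rewrite -mulmxA -rowE [RHS]mxE.
by rewrite /part /= !YY.
Qed.

Let part_eq0_2 : part 0 = 0 /\ part 1 = 0 /\ part 2 = 0 <->
  forall v w, tri T y v w = 0.
Proof.
split=> [[part0 [part1 part2]] v w|yvw].
  have yy u : tri T y y u = 0 by move: u; apply/part_eq0_1.
  have yvv (u : 'rV[k]_3) : u 0 i = 0 -> tri T y u u = 0.
    by move=> ui; have := part_eval 2 ui; rewrite part2 meval0 /= => <-.
  have [v' v'i ->] := away v; have [w' w'i ->] := away w.
  rewrite !triE !yy (tri_sym23 _ _ y) // yy !mulr0 !add0r.
  (* Polarization of the quadratic form T(y, ., .) on the displacements, 2 being invertible. *)
  apply: (mulfI nz2); rewrite mulr0.
  have vwi : (v' + w') 0 i = 0 by rewrite mxE v'i w'i addr0.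
  have := yvv _ vwi; rewrite !triE !yvv // (tri_sym23 _ w') // => <-.
  by ring.
have YA A B : tri Tm Y A B = 0.
  rewrite tri_sym13 // /tri contract_Tm.
  suff -> : contract T y = 0 by rewrite map_mx0 mulmx0 mul0mx mxE.
  apply/matrixP=> a b; rewrite mxE -(yvw (delta_mx 0 b) (delta_mx 0 a)).
  by rewrite (tri_sym13 y) // /tri -rowE trmx_delta -colE !mxE.
by rewrite /part /= !YA.
Qed.

(** If T(y, ., .) = 0, then T(v, v, v) depends only on the displacement component of v, so a
    vanishing cubic part would give F = 0. The multiplicity is thus exactly 3. *)
Let cone_neq0 : (forall v w, tri T y v w = 0) -> part 3 != 0.
Proof.
move=> yvw; apply: contra_neq nzF => part3; apply: tri_cubic_tensor_eq0 => v.
have vyw u w : tri T u y w = 0 by rewrite tri_sym12.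
have vwy u w : tri T u w y = 0 by rewrite tri_sym13.
have [v' v'i ->] := away v; have := part_eval 3 v'i.
by rewrite part3 meval0 /= !triE !(yvw, vyw, vwy) => <-; rewrite !mulr0 !addr0.
Qed.

Lemma local_order3 : order_at_origin (local_equation F p i) 3 <->
  forall v w, tri T p v w = 0.
Proof.
have -> : (forall v w, tri T p v w = 0) <-> (forall v w, tri T y v w = 0).
  split=> e v w; last by rewrite py triZl e mulr0.
  by apply: (mulfI pi_neq0); rewrite -triZl -py mulr0.
rewrite local_order // -part_eq0_2; split=> [[low _]|e]; first by rewrite !low.
split; last exact/cone_neq0/part_eq0_2.
case: e => e0 [e1 e2] [|[|[|d]]] ltd; [exact: e0 | exact: e1 | exact: e2 |].
by exfalso; move: ltd.
Qed.

Lemma local_order2 : order_at_origin (local_equation F p i) 2 <->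
  (forall v, tri T p p v = 0) /\ ~ (forall v w, tri T p v w = 0).
Proof.
have -> : (forall v w, tri T p v w = 0) <-> (forall v w, tri T y v w = 0).
  split=> e v w; last by rewrite py triZl e mulr0.
  by apply: (mulfI pi_neq0); rewrite -triZl -py mulr0.
have -> : (forall v, tri T p p v = 0) <-> (forall v, tri T y y v = 0).
  split=> e v; last by rewrite py triZl triZm e !mulr0.
  apply: (mulfI pi_neq0); apply: (mulfI pi_neq0).
  by rewrite -triZm -triZl -py e !mulr0.
rewrite local_order // -part_eq0_2 -part_eq0_1; split=> [[low nz2']|[[e0 e1] e2]].
  split; first by rewrite !low.
  by case=> _ [_ part2]; rewrite part2 eqxx in nz2'.
split; last by apply: contra_notN e2 => /eqP part2; split.
case=> [|[|d]] ltd; [exact: e0 | exact: e1 |].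
by exfalso; move: ltd.
Qed.

End LocalEquation.

Lemma normalize_coordinate (p : 'rV[k]_3) i : p 0 i != 0 ->
  exists2 y : 'rV[k]_3, y 0 i = 1 & p = p 0 i *: y.
Proof.
move=> nzi; exists ((p 0 i)^-1 *: p); first by rewrite mxE mulVf.
by rewrite scalerA mulfV // scale1r.
Qed.

Lemma triple_point_tri p : triple_point F p <->
  p != 0 /\ forall v w, tri T p v w = 0.
Proof.
split=> [[i nzi]|[/rV0Pn[i nzi] e]].
  have [y yi py] := normalize_coordinate nzi.
  move=> /(local_order3 nzi yi py) e.
  by split=> //; apply/rV0Pn; exists i.
have [y yi py] := normalize_coordinate nzi.
by exists i => //; apply/(local_order3 nzi yi py).
Qed.

Lemma double_point_tri p : double_point F p <->
  [/\ p != 0, forall v, tri T p p v = 0 & ~ (forall v w, tri T p v w = 0)].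
Proof.
split=> [[i nzi]|[/rV0Pn[i nzi] e1 e2]].
  have [y yi py] := normalize_coordinate nzi.
  move=> /(local_order2 nzi yi py)[e1 e2].
  by split=> //; apply/rV0Pn; exists i.
have [y yi py] := normalize_coordinate nzi.
by exists i => //; apply/(local_order2 nzi yi py).
Qed.

End Multiplicity.

(** * Restriction of the cubic to a line *)

Section Restriction.
Variable k : closedFieldType.
Hypotheses (nz2 : 2 != 0 :> k) (nz3 : 3 != 0 :> k).
Variables (F S : {mpoly k[3]}).
Hypotheses (hF : is_form 3 F) (hS : is_form 1 S).

Let nz6 : 6 != 0 :> k.
Proof. by rewrite (_ : 6 = 2 * 3) ?mulf_neq0 //; ring. Qed.

Let T := cubic_tensor F.
Let sT : symmetric_tensor T := cubic_tensor_sym F.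
Let s := line_row S.

Lemma restrictionE (p q : 'rV[k]_3) : restriction F p q *+ 6 =
  (tri T p p p)%:P + (tri T p p q)%:P * 'X *+ 3
  + (tri T p q q)%:P * 'X^2 *+ 3 + (tri T q q q)%:P * 'X^3.
Proof.
pose P := map_mx (@polyC k) p; pose Q := map_mx (@polyC k) q.
have -> : restriction F p q = mmap (@polyC k) (fun i => (P + 'X *: Q) 0 i) F.
  apply: eq_bigr => m _; congr (_ * _); apply: mmap1_eq => j.
  by rewrite !mxE -mul_polyC mulrC.
rewrite (cubic_tensor_morph (@polyC k) (P + 'X *: Q) hF).
have sTp : symmetric_tensor (map_tensor (@polyC k) T).
  by case: sT => s12 s23; split=> a b c; rewrite /map_tensor [LHS]mxE [RHS]mxE;
     congr _%:P.
rewrite !triE.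
have [-> ->] : tri (map_tensor (@polyC k) T) P Q P =
  tri (map_tensor (@polyC k) T) P P Q /\ tri (map_tensor (@polyC k) T) Q P P =
  tri (map_tensor (@polyC k) T) P P Q.
  by split; [apply: tri_sym23 | apply: tri_sym13].
have [-> ->] : tri (map_tensor (@polyC k) T) Q P Q =
  tri (map_tensor (@polyC k) T) P Q Q /\ tri (map_tensor (@polyC k) T) Q Q P =
  tri (map_tensor (@polyC k) T) P Q Q.
  by split; [apply: tri_sym12 | apply: tri_sym13].
rewrite /P /Q -!(map_tri (@polyC k)) /=.
by move: (_%:P) (_%:P) (_%:P) (_%:P) => a b c d; ring.
Qed.

Lemma mup_restriction3 (p q : 'rV[k]_3) : mup 0 (restriction F p q) = 3 <->
  [/\ tri T p p p = 0, tri T p p q = 0, tri T p q q = 0 & tri T q q q != 0].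
Proof.
have e := restrictionE p q; split=> [mup3|[e0 e1 e2 e3]].
  have nzr : restriction F p q != 0.
    (* By convention [mup] is 0 at the zero polynomial, so multiplicity 3 excludes it. *)
    apply: contra_eq_neq mup3 => ->; rewrite /mup size_poly0.
    by case: arg_maxnP => // -[[]].
  have := mup_geq 0 3 nzr; rewrite mup3 leqnn subr0 => /esym/dvdpP[u eu].
  have coef i : (u * 'X^3)`_i * 6 = (restriction F p q *+ 6)`_i.
    by rewrite eu coefMn mulr_natr.
  rewrite e in coef.
  move: (coef 0%N) (coef 1%N) (coef 2%N); rewrite !coefMXn /= !mul0r.
  rewrite !(coefMn, coefD) !coefCM !coefC !coefX !coefXn /=.
  rewrite !(mulr0, mulr1, mul0rn, addr0, add0r) => e0 /esym/eqP e1 /esym/eqP e2.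
  rewrite -mulr_natr mulf_eq0 (negPf nz3) orbF in e1.
  rewrite -mulr_natr mulf_eq0 (negPf nz3) orbF in e2.
  split; [by []|exact/eqP|exact/eqP|]; apply: contra_neq nzr => e3.
  apply: (mulIf (_ : 6%:R%:P != 0 :> {poly k})); first by rewrite polyC_eq0.
  rewrite polyC_natr mulr_natr mul0r e -e0 (eqP e1) (eqP e2) e3.
  by rewrite !mul0r !mul0rn !addr0.
have -> : restriction F p q = (tri T q q q / 6)%:P * 'X^3.
  apply: (mulIf (_ : 6%:R%:P != 0 :> {poly k})); first by rewrite polyC_eq0.
  rewrite polyC_natr mulr_natr e e0 e1 e2 !mul0r !mul0rn !add0r.
  by rewrite mulrAC -polyC_natr -polyCM divfK.
rewrite mupMr ?rootC ?mulf_neq0 ?invr_neq0 //.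
by rewrite -['X]subr0 mup_XsubCX eqxx.
Qed.

End Restriction.

(** * The conditions imply semistability *)

Section Sufficiency.
Variable k : closedFieldType.
Hypotheses (nz2 : 2 != 0 :> k) (nz3 : 3 != 0 :> k).
Variables (F S : {mpoly k[3]}).
Hypotheses (hF : is_form 3 F) (hS : is_form 1 S).

Let nz6 : 6 != 0 :> k.
Proof. by rewrite (_ : 6 = 2 * 3) ?mulf_neq0 //; ring. Qed.

Let T := cubic_tensor F.
Let sT : symmetric_tensor T := cubic_tensor_sym F.
Let s := line_row S.

Hypothesis nzs : s != 0.
Hypothesis no_triple_point :
  forall p, p != 0 -> ~ (forall v w, tri T p v w = 0).
Hypothesis no_double_point_on_line :
  forall p, p != 0 -> dot s p = 0 -> ~ (forall v, tri T p p v = 0).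
Hypothesis no_triple_tangent : forall p q r, \det (frame p q r) = 1 ->
  dot s p = 0 -> dot s q = 0 ->
  tri T p p p = 0 -> tri T p p q = 0 -> tri T p q q <> 0.

Let semistable_frame p q r (h := frame p q r) (T' := pullback h T) (s' := s *m h) :
  \det h = 1 ->
  [|| inv1 T' s' != 0, inv2 T' s' != 0, inv3 T' s' != 0 | inv4 T' s' != 0] ->
  semistable F S.
Proof.
move=> deth; rewrite /T' /s' inv1_pullback // inv2_pullback //.
by rewrite inv3_pullback // inv4_pullback //; apply: semistable_inv.
Qed.

(** No triple tangency gives T(p, q, q) <> 0, and smoothness of C at p gives T(p, p, r) <> 0; det M
    is a product of powers of these two and of s(r), up to a nonzero constant. *)
Lemma double_root_semistable p q r : \det (frame p q r) = 1 ->
  dot s p = 0 -> dot s q = 0 -> tri T p p p = 0 -> tri T p p q = 0 ->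
  semistable F S.
Proof.
move=> deth sp sq ppp ppq; apply: (semistable_frame deth); apply/orP; left.
have nzr := dot_frame_neq0 nzs deth sp sq.
have pqq : tri T p q q != 0 by apply/eqP/(no_triple_tangent deth).
have [nzp _] := frame_neq0 deth.
have ppr : tri T p p r != 0.
  apply/eqP => ppr; apply: (no_double_point_on_line nzp sp) => v.
  have [a [b [c ->]]] := frame_basis v deth.
  by rewrite !triDr !triZr ppp ppq ppr !mulr0 !addr0.
rewrite inv1_double_root ?pullbackE ?row_frame ?mulmx_frame //.
- by rewrite !mulf_neq0 ?expf_neq0 ?oppr_eq0 // tri_sym23.
- exact: pullback_sym.
Qed.

Lemma distinct_roots_semistable p q r : \det (frame p q r) = 1 ->
  dot s p = 0 -> dot s q = 0 -> tri T p p q = 0 -> tri T p q q = 0 ->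
  tri T p p p != 0 -> tri T q q q != 0 -> semistable F S.
Proof.
move=> deth sp sq ppq pqq ppp qqq.
(* Correcting r by multiples of p and q removes the terms x^2 z and y^2 z. *)
pose a := - tri T p p r / tri T p p p; pose b := - tri T q q r / tri T q q q.
pose r' := r + a *: p + b *: q.
have deth' : \det (frame p q r') = 1.
  by rewrite -deth /r' !det_frameE !mxE; ring.
have ppr' : tri T p p r' = 0.
  by rewrite /r' !triDr !triZr ppq mulr0 addr0 /a divfK // subrr.
have qqr' : tri T q q r' = 0.
  have qqp : tri T q q p = 0 by rewrite tri_sym13.
  by rewrite /r' !triDr !triZr qqp mulr0 addr0 /b divfK // subrr.
have nzr := dot_frame_neq0 nzs deth' sp sq.
apply: (semistable_frame deth').
set h := frame p q r'; set T' := pullback h T; set s' := s *m h.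
have sT' : symmetric_tensor T' by apply: pullback_sym.
have T'E i j l : T' l i j = tri T (row i h^T) (row j h^T) (row l h^T).
  exact: pullbackE.
have T000 : T' i0 i0 i0 = tri T p p p by rewrite T'E !row_frame.
have T111 : T' i1 i1 i1 = tri T q q q by rewrite T'E !row_frame.
have T001 : T' i1 i0 i0 = 0 by rewrite T'E !row_frame.
have T011 : T' i1 i0 i1 = 0 by rewrite T'E !row_frame.
have T002 : T' i2 i0 i0 = 0 by rewrite T'E !row_frame.
have T112 : T' i2 i1 i1 = 0 by rewrite T'E !row_frame.
have s0 : s' 0 i0 = 0 by rewrite mulmx_frame.
have s1 : s' 0 i1 = 0 by rewrite mulmx_frame.
have s2 : s' 0 i2 != 0 by rewrite mulmx_frame.
pose m := - s' 0 i2 ^+ 2 * T' i0 i0 i0 * T' i1 i1 i1.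
have nzm : m != 0.
  by rewrite /m T000 T111 !mulf_neq0 ?oppr_eq0 ?expf_neq0.
have [T012|T012] := eqVneq (T' i2 i0 i1) 0; last first.
  apply/orP; left; rewrite inv1_distinct_roots //.
  apply: mulf_neq0; last by rewrite expf_neq0 // mulf_neq0.
  by rewrite mulf_neq0 // ?oppr_eq0 // expf_neq0.
have [T222|T222] := eqVneq (T' i2 i2 i2) 0; last first.
  apply/orP; right; apply/orP; left; rewrite inv2_distinct_roots //.
  by rewrite mulf_neq0 // mulf_neq0 // expf_neq0.
apply/orP; right; apply/orP; right; apply: contraT; rewrite negb_or !negbK.
rewrite inv3_distinct_roots // inv4_distinct_roots // -/m; clearbody m.
rewrite !(mulf_eq0, expf_eq0, oppr_eq0) /= (negPf nz2) (negPf nzm) (negPf s2) /= orbb.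
move=> /andP[T022_T122 T022_T122'].
(* In the normal form, e f = 0 and a f^3 = d e^3 with a, d nonzero force e = f = 0. *)
have [T022 T122] : T' i2 i0 i2 = 0 /\ T' i2 i1 i2 = 0.
  move: T022_T122'; case/orP: T022_T122 => /eqP e; rewrite e expr0n /= mulr0.
    by rewrite subr0 mulf_eq0 expf_eq0 T000 (negPf ppp) /= => /eqP->.
  by rewrite sub0r oppr_eq0 mulf_eq0 expf_eq0 T111 (negPf qqq) /= => /eqP->.
have [sT12 sT23] := sT'.
(* All coefficients involving z vanish, which makes r' a triple point. *)
have T'2 : T' i2 = 0.
  by apply/matrixP; apply: ord3P; apply: ord3P; rewrite [RHS]mxE //;
     rewrite sT12.
have nzr' : r' != 0.
  by apply: contraNneq nzr => ->; rewrite /dot trmx0 mulmx0 mxE.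
exfalso; apply: (no_triple_point nzr') => v w.
have unith : h \in unitmx by rewrite unitmxE deth' unitr1.
have span (u : 'rV[k]_3) : u = u *m (invmx h)^T *m h^T.
  by rewrite -mulmxA -trmx_mul mulmxV // trmx1 mulmx1.
rewrite tri_sym13 // (span v) (span w).
have -> : r' = delta_mx 0 i2 *m h^T by rewrite -rowE row_frame.
by rewrite -tri_pullback /tri contract_delta -/T' T'2 mulmx0 mul0mx mxE.
Qed.

(* The Hessian of F restricted to L vanishes at some p: T(p, q', .) vanishes on
   L for some q' on L.  Either p or q' is a double root of F on L, or F
   restricted to L is the sum of a cube vanishing at p and a cube vanishing at
   q'. *)
Lemma sufficient_for_semistable : semistable F S.
Proof.
have [p0 nzp0 sp0] := exists_point_on_line s.
have [q0 [r0 [sq0 det0]]] := line_frame nzs nzp0 sp0.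
have [p [q [r [det1 [sp sq hess]]]]] : exists p q r, \det (frame p q r) = 1 /\
    [/\ dot s p = 0, dot s q = 0 &
        tri T p p p * tri T p q q = tri T p p q ^+ 2].
  (* The Hessian of F on L at p0 + y q0 is a + b y + c y^2, and at q0 it is c. Either c = 0 and q0
     is taken, or a root y exists. *)
  pose a := tri T p0 p0 p0 * tri T p0 q0 q0 - tri T p0 p0 q0 ^+ 2.
  pose b := tri T p0 p0 p0 * tri T q0 q0 q0 - tri T p0 p0 q0 * tri T p0 q0 q0.
  pose c := tri T p0 p0 q0 * tri T q0 q0 q0 - tri T p0 q0 q0 ^+ 2.
  have qqp : tri T q0 q0 p0 = tri T p0 q0 q0 by apply: tri_sym13.
  have qpq : tri T q0 p0 q0 = tri T p0 q0 q0 by apply: tri_sym12.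
  have qpp : tri T q0 p0 p0 = tri T p0 p0 q0 by apply: tri_sym13.
  have pqp : tri T p0 q0 p0 = tri T p0 p0 q0 by apply: tri_sym23.
  have [c0|nzc] := eqVneq c 0.
    exists q0, (- 1 *: p0), r0; split.
      by rewrite -[RHS]det0 !det_frameE !mxE; ring.
    rewrite !dotZr sp0 sq0 mulr0 !triZm !triZr qpp qqp; split=> //.
    by move/eqP: c0; rewrite subr_eq0 => /eqP c0; rewrite exprMn -c0; ring.
  pose P : {poly k} := 'X^2 + (b / c) *: 'X + (a / c)%:P.
  have [y /rootP] : exists y, root P y.
    apply/closed_rootP; rewrite /P -addrA size_polyDl size_polyXn //.
    rewrite (leq_ltn_trans (size_polyD _ _)) // gtn_max.
    rewrite (leq_ltn_trans (size_scale_leq _ _)) ?size_polyX //.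
    by rewrite (leq_ltn_trans (size_polyC_leq1 _)).
  rewrite !hornerE => Py; exists (p0 + y *: q0), q0, r0; split.
    by rewrite -[RHS]det0 !det_frameE !mxE; ring.
  rewrite !dotDr !dotZr sp0 sq0 mulr0 addr0; split=> //.
  rewrite !triE qqp qpq qpp pqp.
  have : c * (y ^+ 2 + b / c * y + a / c) = 0 by rewrite Py mulr0.
  have -> : c * (y ^+ 2 + b / c * y + a / c) = c * y ^+ 2 + b * y + a by field.
  move=> e; apply/eqP; rewrite -subr_eq0 -e /a /b /c; apply/eqP; ring.
have [ppp|nzppp] := eqVneq (tri T p p p) 0.
  apply: (double_root_semistable det1) => //; apply/eqP.
  by have /eqP := hess; rewrite ppp mul0r eq_sym sqrf_eq0.
pose A := tri T p p p; pose B := tri T p p q.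
(* T(p, q', p) = 0 by construction, and T(p, q', q) = 0 because the Hessian vanishes at p. Dividing
   r by A keeps the determinant 1. *)
pose q' := - B *: p + A *: q.
pose r' := A^-1 *: r.
have det' : \det (frame p q' r') = 1.
  by rewrite -[RHS]det1 !det_frameE /q' /r' !mxE; field.
have sq' : dot s q' = 0 by rewrite dotDr !dotZr sp sq !mulr0 addr0.
have ppq' : tri T p p q' = 0 by rewrite triDr !triZr mulNr mulrC addNr.
have pq'p : tri T p q' p = 0 by rewrite tri_sym23.
have pq'q : tri T p q' q = 0.
  by rewrite triDm !triZm hess mulNr -expr2 addNr.
have pq'L c d : tri T p q' (c *: p + d *: q) = 0.
  by rewrite triDr !triZr pq'p pq'q !mulr0 addr0.
have pq'q' : tri T p q' q' = 0 := pq'L _ _.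
have [q'q'q'|nzq'] := eqVneq (tri T q' q' q') 0; last first.
  exact: (distinct_roots_semistable det').
have det'' : \det (frame q' (- 1 *: p) r') = 1.
  by rewrite -[RHS]det' !det_frameE !mxE; ring.
apply: (double_root_semistable det'') => //; first by rewrite dotZr sp mulr0.
by rewrite triZr (tri_sym13 q') // pq'q' mulr0.
Qed.

End Sufficiency.

(** * Destabilizing one-parameter subgroups *)

Section Destabilization.
Variable k : closedFieldType.
Implicit Types (F S : {mpoly k[3]}).

Lemma comp_mpoly_scale n (R : comNzRingType) (c : 'I_n -> R) (p : {mpoly R[n]}) m :
  (p \mPo [tuple c i *: 'X_i | i < n])@_m = p@_m * \prod_i c i ^+ m i.
Proof.
have scaleX u : 'X_[u] \mPo [tuple c i *: 'X_i | i < n] =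
    (\prod_i c i ^+ u i) *: 'X_[u] :> {mpoly R[n]}.
  rewrite comp_mpolyX [in RHS]mpolyXE_id -scaler_prod.
  by apply: eq_bigr => i _; rewrite tnth_mktuple exprZn.
rewrite comp_mpolyEX raddf_sum /=.
under eq_bigr => u _ do rewrite scaleX !mcoeffZ mcoeffX.
have [mp|mp] := boolP (m \in msupp p); last first.
  rewrite big_seq [LHS]big1; last first.
    move=> u up; case: eqP => [e|_]; last by rewrite !mulr0.
    by rewrite -e up in mp.
  by have := mp; rewrite -mcoeff_eq0 => /eqP->; rewrite mul0r.
rewrite (bigD1_seq m) //= eqxx mulr1 [X in _ + X]big1 ?addr0 // => u /negPf ->.
by rewrite !mulr0.
Qed.

Section DiagonalWeights.
Variables (F S : {mpoly k[3]}) (r : 'I_3 -> int) (c : int).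
Hypotheses (hF : is_form 3 F) (hS : is_form 1 S) (sum_r : \sum_i r i = 0).
Hypothesis wF : forall m : 'X_{1..3}, F@_m != 0 -> c + 1 <= \sum_i r i * (m i)%:Z.
Hypothesis wS : forall i, S@_(U_(i)) != 0 -> - c <= r i.

(** The inverse cancels the one in [act], so that x_i is replaced by t^(r i) x_i. *)
Let torus (t : k) : 'M[k]_3 := invmx (diag_mx (\row_i t ^ r i)).

Let prod_exprz (t : k) (I : finType) (f : I -> int) : t != 0 ->
  \prod_i t ^ f i = t ^ (\sum_i f i).
Proof.
by move=> nzt; elim/big_rec2: _ => [|i n x _ ->]; rewrite ?expr0z // expfzDr.
Qed.

Let det_torus (t : k) : t != 0 -> \det (diag_mx (\row_i t ^ r i)) = 1.
Proof.
move=> nzt; rewrite det_diag; under eq_bigr do rewrite mxE.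
by rewrite prod_exprz // sum_r expr0z.
Qed.

Let act_torus (t : k) (G : {mpoly k[3]}) m : 
  (act (torus t) G)@_m = G@_m * \prod_i (t ^ r i) ^+ m i.
Proof.
rewrite /act /torus invmxK -comp_mpoly_scale; congr (_ \mPo _)@__.
apply: eq_mktuple => i; rewrite (bigD1 i) //= big1 => [|j /negPf nij].
  by rewrite addr0 !mxE eqxx mulr1n.
by rewrite !mxE eq_sym nij mulr0n scale0r.
Qed.

Let wt (x : 'I_(10 + 3)) : int :=
  match split x with
  | inl a => \sum_i r i * (tnth cubic_exponents a i)%:Z
  | inr b => r b
  end.

Let coords_torus (t : k) x : t != 0 ->
  coords (act (torus t) F) (act (torus t) S) x = coords F S x * t ^ wt x.
Proof.
move=> nzt; have powE m : \prod_i (t ^ r i) ^+ m i = t ^ (\sum_i r i * (m i)%:Z).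
  rewrite -prod_exprz //; apply: eq_bigr => i _.
  by rewrite exprnP exprz_exp.
rewrite /coords /wt; case: (split x) => [a|b]; rewrite act_torus powE //.
congr (_ * t ^ _); rewrite (bigD1 b) //= big1 => [|j /negPf nbj].
  by rewrite addr0 mnm1E eqxx mulr1.
by rewrite mnm1E eq_sym nbj mulr0.
Qed.

(** The bounds c + 1 and -c add up to 1, so a monomial of bidegree (d, d) that is nonzero at (F, S)
    has weight at least d > 0. The section is constant on the orbit of the torus and tends to 0
    there. *)
Lemma diagonal_unstable : ~ semistable F S.
Proof.
case=> d [sec [d_gt0 Osec inv_sec nz_sec]].
pose E (m : 'X_{1..10 + 3}) : int := \sum_x wt x * (m x)%:Z.
pose C m := sec@_m * \prod_x coords F S x ^+ m x.
have E_gt0 m : m \in msupp sec -> C m != 0 -> 0 < E m.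
  move=> /Osec[dF dS]; rewrite /C mulf_eq0 negb_or => /andP[_ /prodf_neq0 nzC].
  have nz x : m x != 0%N -> coords F S x != 0.
    by move=> mx; have := nzC x isT; rewrite expf_eq0 lt0n mx.
  have bound (I : finType) (e : I -> 'I_(10 + 3)) (b : int) :
      (forall i, m (e i) != 0%N -> b <= wt (e i)) ->
      b * (\sum_i m (e i))%N%:Z <= \sum_i wt (e i) * (m (e i))%:Z.
    move=> wtb; rewrite (big_morph Posz PoszD (erefl _)) mulr_sumr.
    apply: ler_sum => i _.
    have [->|mi] := eqVneq (m (e i)) 0%N; first by rewrite !mulr0.
    by rewrite ler_wpM2r // wtb.
  rewrite /E big_split_ord /=.
  have lF := @bound _ (@lshift 10 3) (c + 1).
  have lS := @bound _ (@rshift 10 3) (- c).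
  rewrite dF in lF; rewrite dS in lS.
  rewrite (lt_le_trans _ (lerD (lF _) (lS _))) //.
  - by rewrite -mulrDl addrAC subrr add0r mul1r ltz_nat.
  - move=> a /nz; rewrite /coords /wt (unsplitK (inl _)); exact: wF.
  - move=> a /nz; rewrite /coords /wt (unsplitK (inr _)); exact: wS.
(* The section along the orbit, as a polynomial in t; the absolute value changes nothing where C m
   <> 0, since E m > 0 there. *)
pose q : {poly k} := \sum_(m <- msupp sec) C m *: 'X^(`|E m|%N).
have q0 : q.[0] = 0.
  rewrite /q horner_sum big_seq big1 // => m /E_gt0 Em.
  rewrite hornerZ hornerXn; have [->|/Em] := eqVneq (C m) 0; first by rewrite mul0r.
  by move=> E_pos; rewrite expr0n absz_eq0 gt_eqF // mulr0.
have qt t : t != 0 -> q.[t] = sec.@[coords F S].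
  move=> nzt; rewrite -(inv_sec (torus t)) //; last first.
    by rewrite det_inv det_torus // invr1.
  rewrite mevalE horner_sum !big_seq; apply: eq_bigr => m msec.
  rewrite hornerZ hornerXn.
  have -> : \prod_x coords (act (torus t) F) (act (torus t) S) x ^+ m x =
      (\prod_x coords F S x ^+ m x) * t ^ E m.
    rewrite -prod_exprz // -big_split /=.
    apply: eq_bigr => x _; rewrite coords_torus // exprMn; congr (_ * _).
    by rewrite exprnP exprz_exp.
  rewrite mulrA -/(C m); have [->|/(E_gt0 m msec) Em] := eqVneq (C m) 0.
    by rewrite !mul0r.
  by congr (_ * _); rewrite exprnP gez0_abs // ltW.
(* The factor X covers t = 0, so every element of k is a root; k is infinite. *)
have : 'X * (q - (sec.@[coords F S])%:P) == 0.
  apply: contraT => /closed_nonrootP[t /negP[]].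
  rewrite rootM rootX; have [//|nzt] := eqVneq t 0.
  by rewrite /root !hornerE qt // subrr.
rewrite mulf_eq0 polyX_eq0 subr_eq0 => /eqP qE.
by move: nz_sec; rewrite -[sec.@[_]](hornerC _ 0) -qE q0 eqxx.
Qed.

End DiagonalWeights.

(** * Destabilization in an adapted frame *)

Section FrameWeights.
Hypothesis nz6 : 6 != 0 :> k.
Variables (F S : {mpoly k[3]}).
Hypotheses (hF : is_form 3 F) (hS : is_form 1 S).

Let T := cubic_tensor F.
Let sT : symmetric_tensor T := cubic_tensor_sym F.
Let s := line_row S.

(** Moving the pair by the inverse of h preserves semistability. A nonzero coefficient of the new
    cubic comes from a nonzero value of T on the frame, of the same weight. *)
Lemma frame_unstable p q r (h := frame p q r) (w : 'I_3 -> int) (c : int) :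
  \det h = 1 -> \sum_i w i = 0 ->
  (forall i j l, tri T (row i h^T) (row j h^T) (row l h^T) != 0 ->
     c + 1 <= w i + w j + w l) ->
  (forall i, dot s (row i h^T) != 0 -> - c <= w i) -> ~ semistable F S.
Proof.
move=> deth sum_w wT ws [d [sec [d_gt0 Osec inv_sec nz_sec]]].
have det' : \det (invmx h) = 1 by rewrite det_inv deth invr1.
pose F' := act (invmx h) F; pose S' := act (invmx h) S.
have hF' : is_form 3 F' by apply: act_homog.
have hS' : is_form 1 S' by apply: act_homog.
have : semistable F' S' by exists d, sec; rewrite inv_sec.
apply: (@diagonal_unstable _ _ w c) => // [m|i].
  rewrite -(inj_eq (mulIf nz6)) mul0r; apply: contraTT => ltc.
  have /(congr1 (mcoeff m)) := cubic_tensorE hF'.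
  rewrite mcoeffMn negbK mulr_natr => ->; rewrite tri_sumE !raddf_sum big1 //= => l _.
  rewrite raddf_sum big1 //= => j _; rewrite raddf_sum big1 //= => i _.
  rewrite ![variables _ _ _]mxE -!mpolyXD [map_tensor _ _ _ _ _]mxE mcoeffCM mcoeffX.
  case: eqP => [em|_]; last by rewrite mulr0.
  rewrite mulr1 cubic_tensor_act // invmxK pullbackE; apply/eqP.
  apply: contraNT ltc => /wT; rewrite -em.
  rewrite [\sum_i0 _](_ : _ = w i + w j + w l) //.
  have sumU x : \sum_y w y * (U_(x)%MM y)%:Z = w x.
    rewrite (bigD1 x) //= big1 => [|y /negPf nxy].
      by rewrite mnm1E eqxx mulr1 addr0.
    by rewrite mnm1E eq_sym nxy mulr0.
  rewrite -!sumU -!big_split /=; apply: eq_bigr => y _.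
  by rewrite !mnmDE !PoszD !mulrDr.
move=> nz; apply: ws; move: nz.
have -> : S'@_(U_(i)) = line_row S' 0 i by rewrite mxE.
rewrite line_row_act // invmxK /dot tr_row trmxK colE mulmxA -colE.
by rewrite [col _ _ _ _]mxE.
Qed.

Let weights (a b c : int) (i : 'I_3) : int :=
  if i == i0 then a else if i == i1 then b else c.

Lemma triple_point_unstable p : p != 0 ->
  (forall v w, tri T p v w = 0) -> ~ semistable F S.
Proof.
move=> nzp pvw; have [q [r deth]] := point_frame nzp.
have vpw v w : tri T v p w = 0 by rewrite tri_sym12.
have vwp v w : tri T v w p = 0 by rewrite tri_sym13.
(* Values of T without p have weight 3 = c + 1; all weights are at least -2 = -c. *)
apply: (frame_unstable (w := weights (- 2) 1 1) (c := 2) deth).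
- by rewrite sum3E /weights !(ord3E, eqxx).
- by do 3 ![apply: ord3P]; rewrite /weights !(ord3E, eqxx) !row_frame
    ?(pvw, vpw, vwp) ?eqxx.
- by apply: ord3P; rewrite /weights !(ord3E, eqxx) !row_frame.
Qed.

Lemma double_point_unstable p : s != 0 -> p != 0 -> dot s p = 0 ->
  (forall v, tri T p p v = 0) -> ~ semistable F S.
Proof.
move=> nzs nzp sp ppv; have [q [r [sq deth]]] := line_frame nzs nzp sp.
have pvp v : tri T p v p = 0 by rewrite tri_sym23.
have vpp v : tri T v p p = 0 by rewrite tri_sym13.
(* Values of T with at most one p have weight at least 0 = c + 1; s is supported on q and r, of
   weight 1 = -c. *)
apply: (frame_unstable (w := weights (- 2) 1 1) (c := - 1) deth).
- by rewrite sum3E /weights !(ord3E, eqxx).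
- by do 3 ![apply: ord3P]; rewrite /weights !(ord3E, eqxx) !row_frame
    ?(ppv, pvp, vpp) ?eqxx.
- by apply: ord3P; rewrite /weights !(ord3E, eqxx) !row_frame ?sp ?eqxx.
Qed.

Lemma triple_tangent_unstable p q r : \det (frame p q r) = 1 ->
  dot s p = 0 -> dot s q = 0 ->
  tri T p p p = 0 -> tri T p p q = 0 -> tri T p q q = 0 -> ~ semistable F S.
Proof.
move=> deth sp sq ppp ppq pqq.
have pqp : tri T p q p = 0 by rewrite tri_sym23.
have qpp : tri T q p p = 0 by rewrite tri_sym13.
have qpq : tri T q p q = 0 by rewrite tri_sym12.
have qqp : tri T q q p = 0 by rewrite tri_sym13.
(* The least remaining weight is that of T(q, q, q), namely -3 = c + 1, just below T(p, p, r) with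
   -2; s is supported on r, of weight 4 = -c. *)
apply: (frame_unstable (w := weights (- 3) (- 1) 4) (c := - 4) deth).
- by rewrite sum3E /weights !(ord3E, eqxx).
- by do 3 ![apply: ord3P]; rewrite /weights !(ord3E, eqxx) !row_frame
    ?(ppp, ppq, pqq, pqp, qpp, qpq, qqp) ?eqxx.
- by apply: ord3P; rewrite /weights !(ord3E, eqxx) !row_frame ?(sp, sq) ?eqxx.
Qed.

End FrameWeights.
End Destabilization.

(** * Multiple components *)

Section DoubleLine.
Variable k : closedFieldType.
Implicit Types (F G H : {mpoly k[3]}).

Lemma homog_lead_deg d F : is_form d F -> F != 0 -> mdeg (mlead F) = d.
Proof. by move=> /dhomogP hF nzF; apply: hF; apply: mlead_supp. Qed.

Lemma mdeg_le_mlead F m : m \in msupp F -> (mdeg m <= mdeg (mlead F))%N.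
Proof.
move=> mF; have nzF : F != 0 by apply: contraTneq mF => ->; rewrite msupp0.
by rewrite -ltnS mlead_deg // msize_mdeg_lt.
Qed.

(** Degrees give deg G = deg H = 1. If G had a nonzero constant term, the vanishing of the terms of
    F of degree 0 and 1 would kill those of H, so H = 0. *)
Lemma square_factor_linear F G H : is_form 3 F -> F != 0 ->
  F = G ^+ 2 * H -> (1 < msize G)%N -> is_form 1 G.
Proof.
move=> hF nzF eF G_gt1.
have nzG : G != 0 by apply: contraTneq G_gt1 => ->; rewrite msize0.
have nzH : H != 0 by apply: contraNneq nzF => H0; rewrite eF H0 mulr0.
have degG_gt0 : (0 < mdeg (mlead G))%N by rewrite -ltnS mlead_deg.
have degF : (mdeg (mlead G) * 2 + mdeg (mlead H) = 3)%N.
  have := homog_lead_deg hF nzF; rewrite eF mleadM ?expf_neq0 //.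
  by rewrite mleadX // mdegD mdegMn.
have [degG degH] : mdeg (mlead G) = 1%N /\ mdeg (mlead H) = 1%N.
  by move: degF degG_gt0; case: (mdeg _) => [|[|n]] //; case: (mdeg _) => [|[|[|]]].
have low d (P : {mpoly k[3]}) i : is_form d.+2 P -> P@_0%MM = 0 /\ P^`M(i)@_0%MM = 0.
  move=> hP; split; first by rewrite (dhomog_nemf_coeff hP) //= mdeg0.
  by rewrite (dhomog_nemf_coeff (dhomog_mderiv i hP)) //= mdeg0.
have G0 : G@_0%MM = 0.
  apply/eqP; apply: contraT => nzG0.
  have [F0 _] := low _ _ i0 hF.
  have H0 : H@_0%MM = 0.
    by move/eqP: F0; rewrite eF !rmorphM /= !mulf_eq0 (negPf nzG0) => /eqP.
  case/negP: nzH; apply/eqP/mpolyP => m; rewrite mcoeff0; apply/eqP.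
  apply: contraT; rewrite -mcoeff_msupp => mH.
  have := mdeg_le_mlead mH; rewrite degH; case: (posnP (mdeg m)) => [/eqP|].
    by rewrite mdeg_eq0 => /eqP m0; rewrite mcoeff_msupp m0 H0 eqxx in mH.
  move=> m_gt0 m_le1.
  have /mdeg1P[i /eqP mi] : mdeg m == 1%N by rewrite eqn_leq m_le1.
  have [_ Fi] := low _ _ i hF; case/negP: mH.
  move: Fi; rewrite eF mderivM mcoeffD !rmorphM /= H0 mulr0 add0r => /eqP.
  rewrite !mulf_eq0 (negPf nzG0) /= mcoeff_deriv add0m mnm0E mulr1n -mi.
  by rewrite mcoeff_msupp => ->.
apply/dhomogP => m mG; apply/eqP; rewrite eqn_leq.
have := mdeg_le_mlead mG; rewrite degG => -> /=.
rewrite lt0n mdeg_eq0; apply: contraTneq mG => ->.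
by rewrite mcoeff_msupp G0 eqxx.
Qed.

Lemma restriction_at0 G p (v : 'rV[k]_3) :
  (restriction G p v).[0] = G.@[fun i => p 0 i].
Proof.
rewrite horner_sum mevalE; apply: eq_bigr => m _.
rewrite hornerM hornerC; congr (_ * _); rewrite horner_prod.
by apply: eq_bigr => i _; rewrite horner_exp !hornerE ?mulr0 ?addr0.
Qed.

(** On each line p + t v the form G is divisible by t, hence F by t^2; the coefficient of t in 6 F
    is 3 T(p, p, v). *)
Lemma square_factor_double_point F G H p : 3 != 0 :> k -> is_form 3 F ->
  F = G ^+ 2 * H -> on_curve G p ->
  forall v, tri (cubic_tensor F) p p v = 0.
Proof.
move=> nz3 hF eF Gp v.
have : 'X %| restriction G p v.
  by rewrite -['X]subr0 dvdp_XsubCl /root restriction_at0 Gp.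
case/dvdpP=> u eu.
have eR : restriction F p v = u ^+ 2 * restriction H p v * 'X^2.
  rewrite [in LHS]eF /restriction rmorphM rmorphXn /=.
  by rewrite -!/(restriction _ p v) eu; ring.
have /(congr1 (fun P : {poly k} => P`_1)) := restrictionE hF p v.
rewrite eR !(coefMn, coefD) coefMXn /= mul0rn !coefCM coefC coefX !coefXn /=.
rewrite !(mulr0, mulr1, mul0rn, addr0, add0r) => /esym/eqP.
by rewrite -mulr_natr mulf_eq0 (negPf nz3) orbF => /eqP.
Qed.

End DoubleLine.

(** * The geometric conditions in terms of the trilinear form *)

Theorem proposition2p6 (k : closedFieldType)
    (char_k2 : 2%N \notin [pchar k]) (char_k3 : 3%N \notin [pchar k])
    (F S : {mpoly k[3]}) (F_cubic : is_form 3 F) (F_neq0 : F != 0)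
    (S_linear : is_form 1 S) (S_neq0 : S != 0) :
  semistable F S <->
  [/\ reduced F /\ ~ (exists p : 'rV[k]_3, triple_point F p),
      ~ line_in_curve F S,
      ~ (exists2 p : 'rV[k]_3, double_point F p & on_curve S p)
    & ~ triple_tangent F S].
Proof.
have nz2 : 2 != 0 :> k by move: char_k2; rewrite inE.
have nz3 : 3 != 0 :> k by move: char_k3; rewrite inE.
have nz6 : 6 != 0 :> k by rewrite (_ : 6 = 2 * 3) ?mulf_neq0 //; ring.
pose T := cubic_tensor F; pose s := line_row S.
have sT : symmetric_tensor T := cubic_tensor_sym F.
have nzs : s != 0.
  apply: contraNneq S_neq0 => s0; rewrite (line_rowE S_linear) big1 // => i _.
  by rewrite -/s s0 mxE mul0r.
have onS p : on_curve S p <-> dot s p = 0 by rewrite /on_curve line_row_eval.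
have onF p : on_curve F p <-> tri T p p p = 0 by apply: on_curve_tri.
split=> [sem|[[red no_triple] no_line no_double no_tangent]].
  have no_double p : p != 0 -> dot s p = 0 -> ~ forall v, tri T p p v = 0.
    by move=> nzp sp /(double_point_unstable nz6 F_cubic S_linear nzs nzp sp).
  split.
  - split=> [G H eF|[p /(triple_point_tri nz2 nz3 F_cubic F_neq0)[nzp pvw]]].
      rewrite leqNgt; apply/negP => G_gt1.
      have G_linear := square_factor_linear F_cubic F_neq0 eF G_gt1.
      have [p [nzp sp Gp]] := lines_meet s (line_row G).
      apply: (no_double p nzp sp).
      apply: (square_factor_double_point nz3 F_cubic eF).
      by rewrite /on_curve line_row_eval.
    exact: (triple_point_unstable nz6 F_cubic S_linear nzp pvw).
  (* If L lies in C, polarization makes T vanish on L, and the weights of a triple tangent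
     destabilize the pair. *)
  - move=> line; have [p nzp sp] := exists_point_on_line s.
    have [q [r [sq deth]]] := line_frame nzs nzp sp.
    have vvv v : dot s v = 0 -> tri T v v v = 0.
      have [->|nzv] := eqVneq v 0; last by move/onS => /(line _ nzv)/onF.
      by rewrite /tri !mul0mx mxE.
    have uvw u v w : dot s u = 0 -> dot s v = 0 -> dot s w = 0 -> tri T u v w = 0.
      move=> su sv sw; apply: (mulfI nz6); rewrite mulr0 polarization //.
      by rewrite !vvv ?dotDr ?su ?sv ?sw ?addr0 // !subr0.
    by apply: (triple_tangent_unstable nz6 F_cubic S_linear deth) sem => //;
       apply: uvw.
  - case=> p /(double_point_tri nz2 nz3 F_cubic)[nzp ppv _] /onS sp.
    exact: no_double ppv.
  - case=> _ [p [nzp _ /onS sp _ [q [/onS sq npq]]]].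
    move=> /(mup_restriction3 nz2 nz3 F_cubic)[ppp ppq pqq qqq].
    (* The point q measuring the multiplicity replaces q0 in the frame; r is rescaled to keep the
       determinant 1. *)
    have [q0 [r [sq0 deth]]] := line_frame nzs nzp sp.
    have [a [b eq]] := line_span nzs deth sp sq0 sq.
    have nzb : b != 0.
      by apply: contraNneq npq => b0; rewrite eq b0 scale0r addr0 scalemx_sub.
    have deth' : \det (frame p q (b^-1 *: r)) = 1.
      by rewrite -[RHS]deth eq !det_frameE !mxE; field.
    exact: (triple_tangent_unstable nz6 F_cubic S_linear deth').
(* A decidable form of the vanishing of T(p, ., .), which separates triple points from double
   ones. *)
have contractE p : (forall v w, tri T p v w = 0) <-> contract T p = 0.
  split=> [e|e v w]; last by rewrite tri_sym13 // /tri e mulmx0 mul0mx mxE.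
  apply/matrixP=> i j; rewrite [RHS]mxE -(e (delta_mx 0 j) (delta_mx 0 i)).
  by rewrite tri_sym13 // /tri -rowE trmx_delta -colE !mxE.
have no_triple' p : p != 0 -> ~ forall v w, tri T p v w = 0.
  move=> nzp pvw; apply: no_triple; exists p.
  exact/(triple_point_tri nz2 nz3 F_cubic F_neq0).
apply: (sufficient_for_semistable nz2 nz3 F_cubic S_linear nzs) => //.
- move=> p nzp sp ppv; have [/contractE|nzT] := eqVneq (contract T p) 0.
    exact: no_triple'.
  apply: no_double; exists p; last exact/onS.
  apply/(double_point_tri nz2 nz3 F_cubic); split=> // /contractE e.
  by rewrite e eqxx in nzT.
- move=> p q r deth sp sq ppp ppq pqq; apply: no_tangent; split=> //.
  have [nzp nzq] := frame_neq0 deth.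
  have triL a b : tri T (a *: p + b *: q) (a *: p + b *: q) (a *: p + b *: q) =
      b ^+ 3 * tri T q q q.
    have pqp : tri T p q p = 0 by rewrite tri_sym23.
    have qpp : tri T q p p = 0 by rewrite tri_sym13.
    have qpq : tri T q p q = 0 by rewrite tri_sym12.
    have qqp : tri T q q p = 0 by rewrite tri_sym13.
    by rewrite !triE ppp ppq pqq pqp qpp qpq qqp; ring.
  have qqq : tri T q q q != 0.
    apply/eqP => qqq; apply: no_line => v nzv /onS sv; apply/onF.
    by have [a [b ->]] := line_span nzs deth sp sq sv; rewrite triL qqq mulr0.
  exists p; split=> //; [exact/onF | exact/onS | |].
    move=> v /onF + /onS sv; have [a [b ->]] := line_span nzs deth sp sq sv.
    rewrite triL => /eqP; rewrite mulf_eq0 expf_eq0 (negPf qqq) orbF /= => /eqP ->.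
    by rewrite scale0r addr0 scalemx_sub.
  exists q; split; first exact/onS.
    apply/negP => /sub_rVP[a eq].
    have [_ /eqP] : - a = 0 /\ 1 = 0 :> k.
      by apply: (frame_indep deth); rewrite eq scale1r scaleNr addNr.
    by rewrite oner_eq0.
  exact/(mup_restriction3 nz2 nz3 F_cubic).
Qed.
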